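(* Let $\Gamma$ be a finitely generated residually finite group with a sequence of finite index normal subgroups $\Gamma=\Gamma_0\unrhd \Gamma_1\unrhd \cdots \unrhd \Gamma_n \unrhd \cdots$ such that $\bigcap_{i\in\mathbb{N}}\Gamma_i=\{e\}$. Let $\square\Gamma$ be the box space associated with this sequence. Then $\Gamma$ is uniformly bounded a-T-menable if and only if $\square\Gamma$ admits a uniformly bounded fibred coarse embedding into Hilbert space.
   Context: **Affine maps.** An affine map between Hilbert spaces is a map $\psi(h)=T(h)+x$ with $T$ linear and $x$ a fixed vector; its norm $\|\psi\|$ is defined to be the operator norm $\|T\|$ of its linear part. It is an affine isomorphism if it has an inverse that is an affine map. $\mathrm{Affine}(H)$ denotes the group of affine isomorphisms of $H$ onto itself. An affine action of a group on $H$ is a homomorphism to $\mathrm{Affine}(H)$. **Uniformly bounded a-T-menability.** A finitely generated (discrete) group $\Gamma$ is uniformly bounded a-T-menable if there exist a separable Hilbert space $H$ and an affine action $\alpha:\Gamma\to \mathrm{Affine}(H)$ such that (i) there is a constant $L>0$ with $\|\alpha_\gamma\|\le L$ for all $\gamma\in\Gamma$; (ii) $\alpha$ is metrically proper: for every bounded subset $B\subset H$ the set $\{\gamma\in\Gamma:\alpha_\gamma(B)\cap B\ne\emptyset\}$ is finite. **Word metric.** Given a finite symmetric generating set $S$ of $\Gamma$, $|\gamma|=\min\{n:\gamma=\sigma_1\cdots\sigma_n,\ \sigma_i\in S\}$ and $d(\gamma_1,\gamma_2)=|\gamma_1^{-1}\gamma_2|$. **Coarse disjoint union.** For a sequence $(X_n)_{n\in\mathbb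 N}$ of bounded metric spaces, a coarse disjoint union is $X=\bigsqcup_n X_n$ with a metric $d$ which restricts to the original metric on each $X_n$ and satisfies $d(X_i,X_j)\ge i+j$ if $i\ne j$. **Box space.** The box space $\square\Gamma$ associated with $\{\Gamma_i\}$ is the coarse disjoint union $\bigsqcup_{i\in\mathbb N}\Gamma/\Gamma_i$, where $\Gamma/\Gamma_i$ carries the quotient metric induced from the word length metric on $\Gamma$. **Uniformly bounded fibred coarse embedding.** Let $H$ be a separable Hilbert space (the model space). A metric space $(X,d)$ admits a uniformly bounded fibred coarse embedding into Hilbert space if there exist a constant $L>0$ and - a field (i.e. family) of Hilbert spaces $(H_x)_{x\in X}$ over $X$; - a section $s:X\to\bigsqcup_{x\in X}H_x$, i.e. $s(x)\in H_x$; - two non-decreasing functions $\rho_-,\rho_+:[0,\infty)\to(-\infty,\infty)$ with $\lim_{t\to\infty}\rho_\pm(t)=\infty$; such that for any $r>0$ there exists a bounded subset $K\subset X$ for which there exists, for each subset $C\subset X\setminus K$ of diameter less than $r$, a trivialization $t_C:(H_x)_{x\in C}\to C\times H$, i.e. a map whose restriction to each fiber $H_x$, $x\in C$, is an affine isomorphism $t_C(x):H_x\to H$ with $\max\{\|t_C(x)\|,\|t_C(x)^{-1}\|\}\le L$, satisfying 1. $\rho_-(d(x,y))\le\|t_C(x)(s(x))-t_C(y)(s(y))\|\le\rho_+(d(x,y))$ for any $x,y\in C$; 2. for any two subsets $C_1,C_2\subset X\setminus K$ of diameter less than $r$ with $C_1\cap C_2\ne\emptyset$, there exists an affine isomorphism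 $t_{C_1C_2}$ on $H$ with $\max\{\|t_{C_1C_2}\|,\|t_{C_1C_2}^{-1}\|\}$ at most $L$ such that $t_{C_1}(x)t_{C_2}(x)^{-1}=t_{C_1C_2}$ for all $x\in C_1\cap C_2$. *)

(* Defs.v *)
From HB Require Import structures.
From mathcomp Require Import all_boot all_order all_algebra.
From mathcomp Require Import all_classical all_reals all_analysis.

Set Implicit Arguments.
Unset Strict Implicit.
Unset Printing Implicit Defensive.

Import Order.TTheory GRing.Theory Num.Theory.
Import numFieldNormedType.Exports.

Local Open Scope classical_set_scope.
Local Open Scope ring_scope.

(* Hilbert spaces are real: a complete normed space whose norm is induced by a
   symmetric positive definite bilinear form. *)
Record hilbertType (R : realType) := HilbertType {
  hilbert_space :> completeNormedModType R;
  hilbert_dot : {dot hilbert_space for (@idfun R)};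
  hilbert_dotE : forall x : hilbert_space, hilbert_dot x x = `|x| ^+ 2
}.

Definition separable (T : topologicalType) : Prop :=
  exists D : set T, countable D /\ dense D.

Section Affine.
Variable R : realType.

(* [+oo] when [T] is unbounded *)
Definition op_norm (H1 H2 : hilbertType R) (T : H1 -> H2) : \bar R :=
  ereal_sup [set (`|T h|)%:E | h in [set h : H1 | `|h| <= 1]].

Definition is_affine (H1 H2 : hilbertType R) (psi : H1 -> H2) : Prop :=
  exists (T : {linear H1 -> H2}) (x : H2), forall h, psi h = T h + x.

(* [psi h - psi 0] is [T h] when [psi h = T h + x]. *)
Definition linear_part (H1 H2 : hilbertType R) (psi : H1 -> H2) : H1 -> H2 :=
  fun h => psi h - psi 0.

Definition affine_norm (H1 H2 : hilbertType R) (psi : H1 -> H2) : \bar R :=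
  op_norm (linear_part psi).

Definition affine_inverses (H1 H2 : hilbertType R)
    (psi : H1 -> H2) (psi' : H2 -> H1) : Prop :=
  [/\ is_affine psi, is_affine psi', cancel psi psi' & cancel psi' psi].

Definition is_affine_iso (H1 H2 : hilbertType R) (psi : H1 -> H2) : Prop :=
  exists psi', affine_inverses psi psi'.

Definition bounded_affine_inverses (L : R) (H1 H2 : hilbertType R)
    (psi : H1 -> H2) (psi' : H2 -> H1) : Prop :=
  [/\ affine_inverses psi psi',
      (affine_norm psi <= L%:E)%E & (affine_norm psi' <= L%:E)%E].

End Affine.

Section Groups.
Variables (R : realType) (G : groupType).

Definition affine_action (H : hilbertType R) (alpha : G -> H -> H) : Prop :=
  (forall g, is_affine_iso (alpha g)) /\
  (forall g k, alpha (g * k)%g = alpha g \o alpha k).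

Definition metrically_proper (H : hilbertType R) (alpha : G -> H -> H) : Prop :=
  forall B : set H, bounded_set B ->
    finite_set [set g | (alpha g @` B) `&` B !=set0].

Definition uniformly_bounded_aTmenable : Prop :=
  exists (H : hilbertType R) (alpha : G -> H -> H),
    [/\ separable H,
        affine_action alpha,
        exists2 L : R, 0 < L & forall g, (affine_norm (alpha g) <= L%:E)%E
      & metrically_proper alpha].

Definition normal_subgroup (N : set G) : Prop :=
  group_closed (mem N) /\ (forall x g, N x -> N (x ^ g)%g).

Definition left_coset (N : set G) (g : G) : set G := [set (g * n)%g | n in N].

Definition left_cosets (N : set G) : set (set G) := range (left_coset N).

Definition finite_index (N : set G) : Prop := finite_set (left_cosets N).

Definition residually_finite : Prop :=
  forall g : G, g <> 1%g ->
    exists N : set G, [/\ normal_subgroup N, finite_index N & ~ N g].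

Definition words (S : set G) (g : G) : set (seq G) :=
  [set w | (forall s, s \in w -> S s) /\ (\prod_(s <- w) s)%g = g].

Definition finite_symmetric_generating (S : set G) : Prop :=
  [/\ finite_set S, forall s, S s -> S (s^-1)%g
    & forall g, words S g !=set0].

(* The infimum of a nonempty set of natural numbers is its minimum. *)
Definition word_length (S : set G) (g : G) : R :=
  inf [set (size w)%:R | w in words S g].

Definition word_dist (S : set G) (g k : G) : R := word_length S (g^-1 * k)%g.

Definition quotient_dist (S : set G) (A B : set G) : R :=
  inf [set word_dist S p.1 p.2 | p in A `*` B].

End Groups.

(* [X], with inclusions [iota i : X_ i -> X], is a coarse disjoint union of the
   [(X_ i, d_ i)]. The metric of [X] is not determined by this. *)
Definition coarse_disjoint_union (R : realType) (X_ : nat -> Type)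
    (d_ : forall i, X_ i -> X_ i -> R)
    (X : metricType R) (iota : forall i, X_ i -> X) : Prop :=
  [/\ bijective (fun p : {i & X_ i} => iota (tag p) (tagged p)),
      forall i (x y : X_ i), mdist (iota i x) (iota i y) = d_ i x y
    & forall i j (x : X_ i) (y : X_ j), i <> j ->
        (i + j)%:R <= mdist (iota i x) (iota j y)].

Definition box_space (R : realType) (G : groupType) (S : set G)
    (N : nat -> set G) (X : metricType R)
    (iota : forall i, left_cosets (N i) -> X) : Prop :=
  coarse_disjoint_union
    (fun i (a b : left_cosets (N i)) => quotient_dist R S (\val a) (\val b))
    iota.

Section FibredCoarseEmbedding.
Variables (R : realType) (X : metricType R).

(* [-oo] on the empty set *)
Definition diameter (C : set X) : \bar R :=
  ereal_sup [set (mdist p.1 p.2)%:E | p in C `*` C].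

Definition control_function (rho : R -> R) : Prop :=
  (forall u v : R, 0 <= u -> u <= v -> rho u <= rho v) /\
  (rho t @[t --> +oo] --> +oo).

(* [t C x] is the trivialization t_C(x) and [t' C x] its inverse; their values
   are irrelevant unless [C] is admissible and contains [x]. *)
Definition uniformly_bounded_fibred_coarse_embedding : Prop :=
  exists (H : hilbertType R) (L : R) (Hx : X -> hilbertType R)
         (s : forall x, Hx x) (rho_m rho_p : R -> R),
    [/\ separable H, 0 < L, control_function rho_m, control_function rho_p &
    forall r : R, 0 < r ->
    exists2 K : set X, (diameter K < +oo)%E &
    let admissible (C : set X) := C `<=` ~` K /\ (diameter C < r%:E)%E in
    exists (t : set X -> forall x, Hx x -> H)
           (t' : set X -> forall x, H -> Hx x),
    [/\ forall C x, admissible C -> C x ->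
          bounded_affine_inverses L (t C x) (t' C x),
        forall C x y, admissible C -> C x -> C y ->
          rho_m (mdist x y) <= `|t C x (s x) - t C y (s y)|
                            <= rho_p (mdist x y)
      & forall C1 C2, admissible C1 -> admissible C2 -> C1 `&` C2 !=set0 ->
          exists tau tau' : H -> H, bounded_affine_inverses L tau tau' /\
            forall x, (C1 `&` C2) x -> t C1 x \o t' C2 x = tau]].

End FibredCoarseEmbedding.

(* Main.v *)
(** From an action to an embedding, all fibres are the model space and the
    section is 0: a set [C] of small diameter far out in the box space lifts
    isometrically to the group, and the trivialization at [x] is the action of the
    lift of [x]. Two lifts of the same set differ by a left translation, which
    gives the transition maps.

    Conversely, fix a quotient G/N in which balls of radius r are admissible
    and compare the section at [xg] and at [x] in the trivialization over the ball
    around [x]; this is a map [v g : G/N -> H] and the transition maps carry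
    [v h (xg)] to [v (gh) x - v g x]. Averaging over G/N turns the [v g] into
    vectors with a positive semidefinite Gram matrix on which G acts with
    bound L up to the radius r. The limit of these Gram matrices along an
    ultrafilter is a kernel on G, and its reproducing kernel Hilbert space carries
    the affine action [w h |-> w (gh)], defined first on combinations of the
    vectors [w h] and then extended by density. *)

Require Import Defs.
From HB Require Import structures.
From mathcomp Require Import finmap.
From mathcomp Require Import all_boot all_order all_algebra.
From mathcomp Require Import all_classical all_reals all_analysis.
From mathcomp Require Import lra.

Set Implicit Arguments.
Unset Strict Implicit.
Unset Printing Implicit Defensive.

Import Order.TTheory GRing.Theory Num.Theory.
Import numFieldNormedType.Exports.

Local Open Scope classical_set_scope.
Local Open Scope ring_scope.

(** * Reproducing kernel Hilbert spaces *)

Section Combinations.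
Variables (R : realType) (I : Type).
Implicit Types (V : lmodType R) (c d : seq (R * I)).

(** Combinations are lists with repetitions allowed: concatenation is their sum, and [I] may be any
    type. *)
Definition comb V (u : I -> V) c : V := \sum_(a <- c) a.1 *: u a.2.

Definition scale_comb (t : R) c := [seq (t * a.1, a.2) | a <- c].

Lemma comb_cat V (u : I -> V) c d : comb u (c ++ d) = comb u c + comb u d.
Proof. exact: big_cat. Qed.

Lemma comb_scale V (u : I -> V) t c :
  comb u (scale_comb t c) = t *: comb u c.
Proof.
by rewrite /comb big_map scaler_sumr; apply: eq_bigr => a _; rewrite scalerA.
Qed.

Lemma comb1 V (u : I -> V) t i : comb u [:: (t, i)] = t *: u i.
Proof. by rewrite /comb big_seq1. Qed.

Lemma linear_comb V V' (T : {linear V -> V'}) (u : I -> V) c :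
  T (comb u c) = comb (T \o u) c.
Proof. by rewrite /comb linear_sum; apply: eq_bigr => a _; rewrite linearZ. Qed.

Definition ev (f : I -> R) c : R := comb (f : I -> R^o) c.

Lemma ev_cat f c d : ev f (c ++ d) = ev f c + ev f d.
Proof. exact: comb_cat. Qed.

Lemma ev_scale f t c : ev f (scale_comb t c) = t * ev f c.
Proof. exact: comb_scale. Qed.

Lemma ev1 f t i : ev f [:: (t, i)] = t * f i.
Proof. exact: comb1. Qed.

Lemma evD f g c : ev (f + g) c = ev f c + ev g c.
Proof.
rewrite /ev /comb -[RHS]big_split; apply: eq_bigr => a _.
exact: mulrDr.
Qed.

Lemma evZ f t c : ev (t *: f) c = t * ev f c.
Proof.
rewrite /ev /comb [RHS]mulr_sumr; apply: eq_bigr => a _; exact: mulrCA.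
Qed.

Lemma evB f g c : ev (f - g) c = ev f c - ev g c.
Proof. by rewrite -scaleN1r evD evZ mulN1r. Qed.

End Combinations.

(** The discriminant argument. For [c > 0] take the minimum [t = - b / c]; for [c = 0] a nonzero
    slope would let the affine function reach [-1]. *)
Lemma le_sqr_of_quadratic_ge0 (R : realFieldType) (a b c : R) :
  (forall t, 0 <= a + 2 * t * b + t ^+ 2 * c) -> 0 <= c -> b ^+ 2 <= a * c.
Proof.
move=> h c0; have [c_eq0|cN0] := eqVneq c 0; last first.
  have {}c0 : 0 < c by rewrite lt_def cN0.
  have := h (- b / c).
  rewrite -(pmulr_rge0 _ c0); set t := - b / c.
  have tc : t * c = - b by rewrite /t divfK.
  by rewrite (_ : c * _ = a * c + 2 * (t * c) * b + (t * c) ^+ 2) ?tc; nra.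
have [->|bN0] := eqVneq b 0.
  by rewrite c_eq0 mulr0 expr0n.
have := h (- (a + 1) / (2 * b)); rewrite c_eq0 mulr0 addr0.
set t := _ / _; have tb : t * (2 * b) = - (a + 1) by rewrite /t divfK // mulf_neq0.
by nra.
Qed.

(** * The function space of a kernel and its completeness *)

Section ReproducingKernel.
Variable R : realType.

Record psd_kernel (I : Type) := PsdKernel {
  kernel_fun :> I -> I -> R;
  kernel_sym : forall i j, kernel_fun i j = kernel_fun j i;
  kernel_psd : forall c, 0 <= ev (comb (kernel_fun : I -> (I -> R)) c) c }.

Variables (I : Type) (K : psd_kernel I).
Implicit Types (c d : seq (R * I)) (f g : I -> R) (M : R).

Definition feature c : I -> R := comb (K : I -> (I -> R)) c.
Definition kform c d := ev (feature c) d.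
Definition knorm c := Num.sqrt (kform c c).

Lemma featureE c i : feature c i = ev (K i) c.
Proof.
rewrite /feature /ev /comb fct_sumE; apply: eq_bigr => a _.
by rewrite kernel_sym.
Qed.

Lemma kformC c d : kform c d = kform d c.
Proof.
rewrite /kform {1}/ev {1}/comb.
under eq_bigr do rewrite featureE.
rewrite /ev /comb.
under eq_bigr => a _ do rewrite scaler_sumr.
rewrite exchange_big /=; apply: eq_bigr => b _.
rewrite /feature /comb fct_sumE scaler_sumr; apply: eq_bigr => a _.
by rewrite /GRing.scale /= mulrCA.
Qed.

Lemma feature_cat c d : feature (c ++ d) = feature c + feature d.
Proof. exact: comb_cat. Qed.

Lemma feature_scale t c : feature (scale_comb t c) = t *: feature c.
Proof. exact: comb_scale. Qed.

Lemma kform_ge0 c : 0 <= kform c c. Proof. exact: kernel_psd. Qed.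

Lemma knorm_ge0 c : 0 <= knorm c. Proof. exact: sqrtr_ge0. Qed.

Lemma sqr_knorm c : knorm c ^+ 2 = kform c c.
Proof. by rewrite sqr_sqrtr ?kform_ge0. Qed.

Lemma kform_perturb c d t :
  kform (c ++ scale_comb t d) (c ++ scale_comb t d) =
  kform c c + 2 * t * kform c d + t ^+ 2 * kform d d.
Proof.
have -> : kform (c ++ scale_comb t d) (c ++ scale_comb t d) =
    kform c c + t * kform c d + (t * kform d c + t * (t * kform d d)).
  by rewrite /kform feature_cat feature_scale evD evZ !ev_cat !ev_scale mulrDr.
by rewrite (kformC d c); lra.
Qed.

Lemma kform_cauchy c d : `|kform c d| <= knorm c * knorm d.
Proof.
rewrite -ler_sqr ?nnegrE ?mulr_ge0 ?knorm_ge0// real_normK ?num_real//.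
rewrite exprMn !sqr_knorm; apply: le_sqr_of_quadratic_ge0 (kform_ge0 _) => t.
by rewrite -kform_perturb kform_ge0.
Qed.

(** The RKHS is built as the dual of the combinations seminormed by [knorm]. This replaces the
    quotient by null combinations followed by a completion. *)
Definition rkhs_bound f M := 0 <= M /\ forall c, `|ev f c| <= M * knorm c.

Lemma rkhs_boundD f g M M' :
  rkhs_bound f M -> rkhs_bound g M' -> rkhs_bound (f + g) (M + M').
Proof.
move=> [M0 fM] [M'0 gM']; split=> [|c]; first exact: addr_ge0.
by rewrite evD mulrDl (le_trans (ler_normD _ _)) ?lerD.
Qed.

Lemma rkhs_boundZ f t M : rkhs_bound f M -> rkhs_bound (t *: f) (`|t| * M).
Proof.
move=> [M0 fM]; split=> [|c]; first exact: mulr_ge0.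
by rewrite evZ normrM -mulrA ler_wpM2l.
Qed.

Lemma rkhs_bound_feature c : rkhs_bound (feature c) (knorm c).
Proof. by split=> [|d]; [exact: knorm_ge0|exact: kform_cauchy]. Qed.

Definition rkhs_pred : {pred I -> R} := [pred f | `[< exists M, rkhs_bound f M >]].

Lemma rkhs_submod : submod_closed rkhs_pred.
Proof.
split=> [|t f g /asboolP[M fM] /asboolP[M' gM']]; apply/asboolP.
  exists 0; split=> // c; rewrite mul0r.
  by have := evZ (0 : I -> R) 0 c; rewrite scale0r mul0r => ->; rewrite normr0.
by exists (`|t| * M + M'); apply: rkhs_boundD => //; exact: rkhs_boundZ.
Qed.

HB.instance Definition _ := GRing.isSubmodClosed.Build R (I -> R) rkhs_pred rkhs_submod.

Definition rkhs := {f : I -> R | f \in rkhs_pred}.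
HB.instance Definition _ := [isSub of rkhs for @sval _ _].
HB.instance Definition _ := [Choice of rkhs by <:].
HB.instance Definition _ := [SubChoice_isSubLmodule of rkhs by <:].

Definition rnorm f : R := inf [set M | rkhs_bound f M].

Lemma rnorm_ge0 f : 0 <= rnorm f.
Proof.
have [[M fM]|noM] := pselect (exists M, rkhs_bound f M).
  by apply: lb_le_inf => [|x []]; first by exists M.
rewrite /rnorm (_ : [set M | _] = set0) ?inf0//.
by apply/seteqP; split=> // M fM; case: noM; exists M.
Qed.

Lemma rnorm_le f M : rkhs_bound f M -> rnorm f <= M.
Proof. by move=> fM; apply: ge_inf => //; exists 0 => x []. Qed.

(** The infimum of the bounds is attained: each bound is at least [|ev f c| / knorm c], and where
    [knorm c = 0] any bound already forces [ev f c = 0]. *)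
Lemma rkhs_bound_rnorm (f : rkhs) : rkhs_bound (val f) (rnorm (val f)).
Proof.
have /asboolP[M fM] := valP f.
split=> [|c]; first exact: rnorm_ge0.
have [c0|cN0] := eqVneq (knorm c) 0.
  by have := fM.2 c; rewrite c0 !mulr0.
have {}cN0 : 0 < knorm c by rewrite lt_def cN0 knorm_ge0.
rewrite -ler_pdivrMr //; apply: lb_le_inf => [|x [_ fx]]; first by exists M.
by rewrite ler_pdivrMr.
Qed.

Definition rkhs_norm (f : rkhs) : R := rnorm (val f).

Lemma rnormD (f g : rkhs) :
  rkhs_norm (f + g) <= rkhs_norm f + rnorm (val g).
Proof.
by apply: rnorm_le; apply: rkhs_boundD; exact: rkhs_bound_rnorm.
Qed.

Lemma rnormZ_le t (f : rkhs) : rkhs_norm (t *: f) <= `|t| * rkhs_norm f.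
Proof. by apply: rnorm_le; apply: rkhs_boundZ; exact: rkhs_bound_rnorm. Qed.

Lemma rnormZ t (f : rkhs) : rkhs_norm (t *: f) = `|t| * rkhs_norm f.
Proof.
apply/le_anti; rewrite rnormZ_le /=.
have [->|t0] := eqVneq t 0; first by rewrite normr0 mul0r rnorm_ge0.
have := rnormZ_le t^-1 (t *: f); rewrite scalerA mulVf// scale1r normfV.
by rewrite mulrC ler_pdivlMr ?normr_gt0// mulrC.
Qed.

Lemma rnorm_eq0 (f : rkhs) : rkhs_norm f = 0 -> f = 0.
Proof.
move=> f0; apply/val_inj/funext => i.
have := (rkhs_bound_rnorm f).2 [:: (1, i)].
by rewrite [rnorm _]f0 mul0r normr_le0 ev1 mul1r => /eqP.
Qed.

HB.instance Definition _ :=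
  @Lmodule_isNormed.Build R rkhs rkhs_norm rnormD rnormZ rnorm_eq0.

Lemma rkhs_ev (f : rkhs) c : `|ev (val f) c| <= `|f| * knorm c.
Proof. exact: (rkhs_bound_rnorm f).2. Qed.

Lemma rkhs_norm_le (f : rkhs) M : rkhs_bound (val f) M -> `|f| <= M.
Proof. exact: rnorm_le. Qed.

(** Evaluations are Lipschitz, so a Cauchy filter converges on every combination. The Cauchy
    estimates pass to this pointwise limit, which makes the convergence one in norm. *)
Lemma rkhs_complete (F : set_system rkhs) : ProperFilter F -> cauchy F -> cvg F.
Proof.
move=> FF /cauchy_ballP cF.
have cvev c : cvg ((fun f : rkhs => ev (val f) c) @ F).
  apply: cauchy_cvg; apply/cauchy_exP => e e0.
  (* The [+ 1] covers combinations with [knorm c = 0]. *)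
  have e'0 : 0 < e / (knorm c + 1) by rewrite divr_gt0 ?ltr_wpDl ?knorm_ge0.
  have /cauchy_ballP/cauchyP/(_ _ e'0)[f Ff] := cF.
  exists (ev (val f) c); 
  change (\forall g \near F, ball (ev (val f) c) e (ev (val g) c)).
  near=> g; rewrite -ball_normE /= -evB.
  have : ball f (e / (knorm c + 1)) g by near: g.
  rewrite -ball_normE /= => fg.
  apply: le_lt_trans (rkhs_ev (f - g) c) _.
  have := knorm_ge0 c; move: fg; rewrite ltr_pdivlMr ?ltr_wpDl ?knorm_ge0//.
  by have := normr_ge0 (f - g); nra.
pose l c := lim ((fun f : rkhs => ev (val f) c) @ F).
pose g i := l [:: (1, i)].
have cvi i : (fun f : rkhs => val f i) @ F --> g i.
  rewrite (_ : (fun f : rkhs => val f i) = fun f : rkhs => ev (val f) [:: (1, i)]).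
    exact: cvev.
  by apply/funext => f; rewrite ev1 mul1r.
have evg c : ev g c = l c.
  apply/esym/cvg_lim => //; elim: c => [|[t i] c IH].
    rewrite /ev /comb big_nil.
    by under eq_fun do rewrite /ev /comb big_nil; exact: cvg_cst.
  rewrite -cat1s ev_cat ev1; under eq_fun do rewrite -cat1s ev_cat ev1.
  by apply: cvgD => //; apply: cvgMr.
have close (f : rkhs) (e : R) : 0 < e -> F (ball f e) -> rkhs_bound (val f - g) e.
  move=> e0 Ff; split=> [|c]; first exact: ltW.
  have cvB : (fun h : rkhs => `|ev (val f) c - ev (val h) c|) @ F
      --> `|ev (val f) c - l c|.
    by apply: cvg_norm; apply: cvgB; [exact: cvg_cst|exact: cvev].
  rewrite evB evg -(cvg_lim _ cvB) //; apply: limr_le.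
    by apply/cvg_ex; eexists; exact: cvB.
  near=> h; have : ball f e h by near: h.
  rewrite -ball_normE /= -evB => /ltW fh.
  by apply: le_trans (rkhs_ev (f - h) c) _; rewrite ler_wpM2r ?knorm_ge0.
have cF' (e : R) : 0 < e -> exists f : rkhs, F (ball f e).
  by move=> e0; have /cauchy_ballP/cauchyP/(_ _ e0) := cF.
have g_rkhs : g \in rkhs_pred.
  have [f Ff] := cF' 1 ltr01; have fg := close f 1 ltr01 Ff.
  have := rkhs_boundD (rkhs_bound_rnorm f) (rkhs_boundZ (-1) fg).
  by rewrite scaleN1r opprB addrC subrK => gM; apply/asboolP; eexists; exact: gM.
apply/cvg_ex; exists (Sub g g_rkhs : rkhs); apply/cvgrPdist_le => /= e e0.
have e20 : 0 < e / 2 by rewrite divr_gt0.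
have [f Ff] := cF' _ e20; near=> h.
have : ball f (e / 2) h by near: h.
rewrite -ball_normE /= => fh.
have gf : `|(Sub g g_rkhs : rkhs) - f| <= e / 2.
  by rewrite distrC; apply: rkhs_norm_le; exact: close.
rewrite -(subrK f (Sub g g_rkhs)) -addrA (le_trans (ler_normD _ _))//.
by lra.
Unshelve. all: by end_near. Qed.

HB.instance Definition _ := Uniform_isComplete.Build rkhs rkhs_complete.

End ReproducingKernel.

(** * Polarization and density arguments *)

Section Polarization.
Variables (R : realType) (V : normedModType R).
Implicit Types (x y z : V) (F G : V -> R).

Definition approx_dense (D : set V) :=
  forall x (e : R), 0 < e -> exists2 y, D y & `|x - y| <= e.

Lemma eq_on_approx_dense (D : set V) F G :
  approx_dense D -> continuous F -> continuous G ->
  (forall x, D x -> F x = G x) -> forall x, F x = G x.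
Proof.
move=> dD cF cG FG x; apply/eqP; apply: contrapT => /negP FGx.
have d0 : 0 < `|F x - G x| by rewrite normr_gt0 subr_eq0.
have cFG : F y - G y @[y --> x] --> F x - G x.
  by apply: cvgB; [exact: cF|exact: cG].
have /cvgrPdist_lt/(_ _ d0) := cFG.
rewrite -nbhs_ballE => -[e /= e0 xe].
have [y Dy xy] := dD x _ (divr_gt0 e0 (ltr0n R 2)).
suff /xe : ball x e y by rewrite /= (FG y Dy) subrr subr0 ltxx.
by rewrite -ball_normE /=; apply: le_lt_trans xy _; rewrite ltr_pdivrMr//; lra.
Qed.

Lemma lipschitz_form_continuous F (M : R) :
  (forall x y, `|F x - F y| <= M * `|x - y|) -> continuous F.
Proof.
move=> FM x; apply/cvgrPdist_le => e e0; near=> y.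
have M0 : 0 < `|M| + 1 by rewrite ltr_wpDl.
apply: le_trans (FM x y) _.
have : `|x - y| <= e / (`|M| + 1).
  by near: y; apply: cvgr_dist_le; [exact: cvg_id|rewrite divr_gt0].
rewrite ler_pdivlMr //.
by have := ler_norm M; have := normr_ge0 (x - y); nra.
Unshelve. all: by end_near. Qed.

(** The future inner product, written with the norm alone, so that it is defined and continuous
    before it is known to be bilinear. *)
Definition polarization x y : R := (`|x + y| ^+ 2 - `|x - y| ^+ 2) / 4.

Lemma polarizationC x y : polarization x y = polarization y x.
Proof. by rewrite /polarization (addrC x) distrC. Qed.

Lemma polarization_sqr x : polarization x x = `|x| ^+ 2.
Proof. by rewrite /polarization subrr normr0 -mulr2n normrMn; lra. Qed.

Lemma continuous_polarization y : continuous (polarization^~ y).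
Proof.
have sqrD z : continuous (fun x => `|x + z| ^+ 2 : R).
  move=> x; have xz : `|x + z| @[x --> x] --> `|x + z|.
    by apply: cvg_norm; apply: cvgD; [exact: cvg_id|exact: cvg_cst].
  exact: (cvgM xz xz).
move=> x; apply: cvgM; last exact: cvg_cst.
by apply: cvgB; exact: sqrD.
Qed.

(** Both sides of the linearity identity are continuous in the second argument, so a dense set of
    such arguments is enough. *)
Lemma polarization_linear (D : set V) :
  approx_dense D -> (forall y, D y -> linear_for *%R (polarization^~ y)) ->
  forall y, linear_for *%R (polarization^~ y).
Proof.
move=> dD linD y t x x'.
have cp z : continuous (polarization z).
  rewrite (_ : polarization z = polarization^~ z).
    exact: continuous_polarization.
  by apply/funext => z'; rewrite polarizationC.
apply: (@eq_on_approx_dense D (polarization (t *: x + x'))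
  (fun y => t * polarization x y + polarization x' y)) => // [|z Dz].
  by move=> z; apply: cvgD; [apply: cvgM; [exact: cvg_cst|exact: cp]|exact: cp].
exact: linD.
Qed.

End Polarization.

(** * The Hilbert structure on the function space *)

Section RKHSHilbert.
Variables (R : realType) (I : Type) (K : psd_kernel R I).
Implicit Types (c d : seq (R * I)) (f g h : rkhs K).

Lemma kernel_in_rkhs i : (K i : I -> R) \in rkhs_pred K.
Proof.
apply/asboolP; exists (knorm K [:: (1, i)]).
rewrite (_ : K i = feature K [:: (1, i)]); first exact: rkhs_bound_feature.
by rewrite /feature comb1 scale1r.
Qed.

Definition rkhs_vec i : rkhs K := Sub (K i) (kernel_in_rkhs i).

Lemma val_comb_rkhs_vec c : val (comb rkhs_vec c) = feature K c.
Proof.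
by rewrite /comb raddf_sum; apply: eq_bigr => a _; exact: linearZ_LR.
Qed.

Lemma norm_comb_rkhs_vec c : `|comb rkhs_vec c| = knorm K c.
Proof.
apply/le_anti/andP; split.
  by apply: rkhs_norm_le; rewrite val_comb_rkhs_vec; exact: rkhs_bound_feature.
have [->//|cN0] := eqVneq (knorm K c) 0.
have {}cN0 : 0 < knorm K c by rewrite lt_def cN0 knorm_ge0.
rewrite -(ler_pM2r cN0) -expr2 sqr_knorm.
by rewrite (le_trans _ (rkhs_ev _ c))// val_comb_rkhs_vec ler_norm.
Qed.

(* A near-minimizer of c |-> |c|^2 - 2 f(c) nearly represents f. *)
Lemma rkhs_vec_total : approx_dense (range (comb rkhs_vec)).
Proof.
move=> f e e0; pose J c := kform K c c - 2 * ev (val f) c.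
have J_lb c : - `|f| ^+ 2 <= J c.
  have := rkhs_ev f c; rewrite /J -sqr_knorm => /(le_trans (ler_norm _)).
  by have := sqr_ge0 (`|f| - knorm K c); lra.
have e20 : 0 < e ^+ 2 by rewrite exprn_gt0.
have Jinf : has_inf (range J).
  split; first by exists (J [::]), [::].
  by exists (- `|f| ^+ 2) => _ [c _ <-].
have [_ [c _ <-] Jc] := inf_adherent e20 Jinf.
exists (comb rkhs_vec c); first by exists c.
apply: rkhs_norm_le; split=> [|d]; first exact: ltW.
rewrite raddfB /= val_comb_rkhs_vec.
rewrite -ler_sqr ?nnegrE ?mulr_ge0 ?knorm_ge0 ?(ltW e0)//.
rewrite real_normK ?num_real// exprMn sqr_knorm.
rewrite evB -[X in X <= _]sqrrN opprB.
apply: le_sqr_of_quadratic_ge0 (kform_ge0 _ _) => t.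
(* A perturbation of [c] cannot go below [inf J], which exceeds [J c - e ^+ 2]; hence the quadratic
   in [t] with constant term [e ^+ 2] is nonnegative. *)
have : inf (range J) <= J (c ++ scale_comb t d).
  by apply: ge_inf; [exact: Jinf.2|exists (c ++ scale_comb t d)].
rewrite /J kform_perturb ev_cat ev_scale -/(kform K c d).
by move: Jc; rewrite /J; lra.
Qed.

(** The reproducing property. By continuity in [f] and density it reduces to combinations, where
    [kform_perturb] at [t = 1] and [t = -1] computes both squared norms. The right side is linear in
    [f], which makes [rkhs_dot] bilinear. *)
Lemma polarization_comb f c : polarization f (comb rkhs_vec c) = ev (val f) c.
Proof.
move: f; apply: (@eq_on_approx_dense R (rkhs K) _ _
  (fun f : rkhs K => ev (val f) c) rkhs_vec_total).
- exact: continuous_polarization.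
- apply: (@lipschitz_form_continuous R (rkhs K) _ (knorm K c)) => g h.
  by rewrite -evB mulrC; exact: (rkhs_ev (g - h)).
move=> _ [d _ <-]; rewrite /polarization.
have norm_comb t : `|comb rkhs_vec d + t *: comb rkhs_vec c| ^+ 2 =
    kform K d d + 2 * t * kform K d c + t ^+ 2 * kform K c c.
  by rewrite -comb_scale -comb_cat norm_comb_rkhs_vec sqr_knorm kform_perturb.
have := norm_comb 1; have := norm_comb (-1).
rewrite scaleN1r scale1r => -> ->; rewrite val_comb_rkhs_vec -/(kform K d c).
by lra.
Qed.

Definition rkhs_dot f g : R := polarization f g.

Lemma rkhs_dot_linear g : linear_for *%R (rkhs_dot^~ g).
Proof.
apply: (polarization_linear rkhs_vec_total) => _ [c _ <-] t f f'.
rewrite !polarization_comb.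
have -> : val (t *: f + f') = t *: val f + val f' by [].
by rewrite evD evZ.
Qed.

Lemma rkhs_dot_bilinear : bilinear_for *%R (idfun \; *%R) rkhs_dot.
Proof.
split=> [g|g t f f']; first exact: rkhs_dot_linear.
have dotC h : rkhs_dot g h = rkhs_dot h g by exact: polarizationC.
by rewrite !dotC rkhs_dot_linear.
Qed.

HB.instance Definition _ :=
  bilinear_isBilinear.Build R (rkhs K) (rkhs K) R *%R (idfun \; *%R) rkhs_dot
    rkhs_dot_bilinear.

Lemma rkhs_dot_hermitian f g :
  rkhs_dot f g = (-1) ^+ false * idfun (rkhs_dot g f).
Proof. by rewrite expr0 mul1r /rkhs_dot polarizationC. Qed.

HB.instance Definition _ :=
  isHermitianSesquilinear.Build R (rkhs K) false idfun rkhs_dot rkhs_dot_hermitian.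

Lemma rkhs_dot_gt0 f : f != 0 -> 0 < rkhs_dot f f.
Proof.
by move=> f0; rewrite /rkhs_dot polarization_sqr exprn_gt0 ?normr_gt0.
Qed.

HB.instance Definition _ := isDotProduct.Build R (rkhs K) rkhs_dot rkhs_dot_gt0.

Definition rkhs_hilbert : hilbertType R :=
  @HilbertType R (rkhs K) rkhs_dot (@polarization_sqr R (rkhs K)).

End RKHSHilbert.

(** The Moore-Aronszajn theorem, phrased by norms of combinations because operators will be extended
    from these. *)
Lemma psd_kernel_realization (R : realType) (I : Type) (K : psd_kernel R I) :
  exists (W : hilbertType R) (w : I -> W),
    (forall c, `|comb w c| ^+ 2 = ev (comb (K : I -> (I -> R)) c) c) /\
    approx_dense (range (comb w)).
Proof.
exists (rkhs_hilbert K), (@rkhs_vec R I K); split; last exact: rkhs_vec_total.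
by move=> c; rewrite -[RHS]sqr_knorm -norm_comb_rkhs_vec.
Qed.

(** * Extension of bounded operators by density *)

Section BoundedExtension.
Variables (R : realType) (I : Type).

Lemma bounded_linear_eq (V V' : normedModType R) (D : set V) (T T' : {linear V -> V'})
    (L L' : R) :
  approx_dense D -> (forall x, `|T x| <= L * `|x|) ->
  (forall x, `|T' x| <= L' * `|x|) -> (forall x, D x -> T x = T' x) ->
  forall x, T x = T' x.
Proof.
move=> dD TL TL' TT' x; apply/eqP; rewrite -subr_eq0 -normr_le0.
apply/ler_addgt0Pr => e e0; rewrite add0r.
pose M := `|L| + `|L'| + 1.
have M0 : 0 < M by rewrite ltr_wpDl ?addr_ge0.
have [y Dy xy] := dD x _ (divr_gt0 e0 M0).
have -> : T x - T' x = T (x - y) - T' (x - y).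
  by rewrite (linearB T) (linearB T') /= (TT' y Dy) opprB addrA subrK.
move: xy; rewrite ler_pdivlMr // => xy.
apply: le_trans (ler_normB _ _) _.
have := ler_wpM2r (normr_ge0 (x - y)) (ler_norm L).
have := ler_wpM2r (normr_ge0 (x - y)) (ler_norm L').
have := TL (x - y); have := TL' (x - y); have := normr_ge0 (x - y).
by rewrite /M in xy; lra.
Qed.

(** The operator is obtained as the closure of the graph of [comb u c |-> comb u' c]. The closure is
    linear and keeps the bound [L], so it is single-valued; completeness of [V'] makes it total. *)
Lemma bounded_linear_extension (V : normedModType R) (V' : completeNormedModType R)
    (u : I -> V) (u' : I -> V') (L : R) :
  0 < L -> approx_dense (range (comb u)) ->
  (forall c, `|comb u' c| <= L * `|comb u c|) ->
  exists T : {linear V -> V'},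
    (forall i, T (u i) = u' i) /\ forall x, `|T x| <= L * `|x|.
Proof.
move=> L0 du uL.
have combB (W : lmodType R) (v : I -> W) c d :
    comb v c - comb v d = comb v (c ++ scale_comb (-1) d).
  by rewrite comb_cat comb_scale scaleN1r.
pose rel x y := forall e : R, 0 < e ->
  exists c, `|x - comb u c| <= e /\ `|y - comb u' c| <= e.
have rel_comb c : rel (comb u c) (comb u' c).
  by move=> e e0; exists c; rewrite !subrr !normr0 ltW.
have rel_lin t x y x' y' : rel x y -> rel x' y' -> rel (t *: x + x') (t *: y + y').
  move=> xy xy' e e0.
  have t0 : 0 < `|t| + 1 by rewrite ltr_wpDl.
  have e'0 : 0 < e / (`|t| + 1) by rewrite divr_gt0.
  have [[c [xc yc]] [d [xd yd]]] := (xy _ e'0, xy' _ e'0).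
  have split_norm (W : normedModType R) (v v' z z' : W) :
      `|v - z| <= e / (`|t| + 1) -> `|v' - z'| <= e / (`|t| + 1) ->
      `|t *: v + v' - (t *: z + z')| <= e.
    move=> vz vz'; rewrite opprD addrACA -scalerBr.
    apply: le_trans (ler_normD _ _) _; rewrite normrZ.
    apply: le_trans (lerD (ler_wpM2l (normr_ge0 t) vz) vz') _.
    by rewrite -[X in _ + X]mul1r -mulrDl mulrC divfK ?gt_eqF.
  exists (scale_comb t c ++ d); rewrite !comb_cat !comb_scale.
  by split; exact: split_norm.
have rel_bound x y : rel x y -> `|y| <= L * `|x|.
  move=> xy; apply/ler_addgt0Pr => e e0.
  have e'0 : 0 < e / (L + 1) by rewrite divr_gt0 // ltr_wpDl // ltW.
  have [c [xc yc]] := xy _ e'0.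
  move: xc yc; rewrite !ler_pdivlMr ?ltr_wpDl // ?(ltW L0) // => xc yc.
  have := uL c; have := ler_normD (y - comb u' c) (comb u' c); rewrite subrK.
  have := ler_normB x (x - comb u c); rewrite subKr.
  have := normr_ge0 (x - comb u c).
  by nra.
have rel_fun x y y' : rel x y -> rel x y' -> y = y'.
  move=> xy xy'; apply/eqP; rewrite -subr_eq0 -normr_le0.
  (* The difference of two values at [x] is related to 0, so its norm is at most [L * 0]. *)
  have := rel_lin (-1) _ _ _ _ xy' xy; rewrite !scaleN1r ![- _ + _]addrC subrr.
  by move=> /rel_bound; rewrite normr0 mulr0.
have rel_ex x : exists y, rel x y.
  (* The value at [x] is the limit of the images of combinations that approach [x]. *)
  pose near_x e := [set c | `|x - comb u c| <= e].
  pose F := filter_from [set e : R | 0 < e] (fun e => comb u' @` near_x e).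
  have FF : ProperFilter F.
    apply: filter_from_proper; last first.
      by move=> e /= e0; have [_ [c _ <-] xc] := du x e e0; exists (comb u' c), c.
    apply: filter_from_filter; first by exists 1; exact: ltr01.
    move=> e e' /= e0 e'0; exists (Num.min e e'); first by rewrite /= lt_min e0.
    move=> _ [c xc <-]; move: xc; rewrite /near_x /= le_min => /andP[xe xe'].
    by split; exists c.
  have cvF : cvg F.
    apply: cauchy_cvg; apply/cauchy_exP => e e0.
    (* Two combinations this close to [x] have images at distance at most [2 * e / 3], below [e]. *)
    have d0 : 0 < e / (3 * L) by rewrite divr_gt0 // mulr_gt0.
    have [_ [c _ <-] xc] := du x _ d0.
    exists (comb u' c); exists (e / (3 * L)) => // _ [d xd <-].
    rewrite -ball_normE /= combB; apply: le_lt_trans (uL _) _; rewrite -combB.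
    move: xc xd; rewrite /near_x /= !ler_pdivlMr ?mulr_gt0 // => xc xd.
    have := ler_normD (comb u c - x) (x - comb u d); rewrite subrKA (distrC _ x).
    by nra.
  exists (lim F) => e e0.
  have : F [set y | `|lim F - y| <= e].
    apply: cvF; apply/nbhs_ballP; exists e => // y.
    by rewrite -ball_normE => /ltW.
  move=> [d /= d0 Fd].
  have m0 : 0 < Num.min d e by rewrite lt_min d0.
  have [_ [c _ <-]] := du x _ m0; rewrite le_min => /andP[xd xe].
  by exists c; split => //; apply: Fd; exists c.
have [T relT] := choice rel_ex.
have T_lin : linear T.
  move=> t x y; apply: rel_fun (relT _) _.
  exact: rel_lin.
pose Tl : {linear V -> V'} :=
  HB.pack T (GRing.isLinear.Build R V V' *:%R T T_lin).
exists Tl; split=> [i|x]; last exact/rel_bound/relT.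
apply: rel_fun (relT _) _.
by have := rel_comb [:: (1, i)]; rewrite !comb1 !scale1r.
Qed.

End BoundedExtension.

(** * Operator norm and pointwise bounds *)

Section OperatorNorm.
Variables (R : realType) (H1 H2 : hilbertType R).

Lemma op_norm_le (T : H1 -> H2) (L : R) :
  0 <= L -> (forall h, `|T h| <= L * `|h|) -> (op_norm T <= L%:E)%E.
Proof.
move=> L0 TL; apply: ge_ereal_sup => _ [h /= h1 <-]; rewrite lee_fin.
by apply: le_trans (TL h) _; rewrite ler_piMr.
Qed.

Lemma op_norm_bound (T : {linear H1 -> H2}) (L : R) :
  (op_norm T <= L%:E)%E -> forall h, `|T h| <= L * `|h|.
Proof.
move=> TL h; have [->|h0] := eqVneq h 0; first by rewrite linear0 !normr0 mulr0.
have {}h0 : 0 < `|h| by rewrite normr_gt0.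
rewrite -ler_pdivrMr // mulrC -[X in X * _]gtr0_norm ?invr_gt0// -normrZ -linearZ.
rewrite -lee_fin; apply: le_trans TL; apply: ereal_sup_ubound.
exists (`|h|^-1 *: h) => //=.
by rewrite normrZ gtr0_norm ?invr_gt0// mulVf ?gt_eqF.
Qed.

Lemma linear_partE (T : {linear H1 -> H2}) (x : H2) (psi : H1 -> H2) :
  (forall h, psi h = T h + x) -> linear_part psi = T.
Proof.
move=> psiE; apply/funext => h.
by rewrite /linear_part !psiE linear0 add0r addrK.
Qed.

End OperatorNorm.

(** * Affine actions from kernels *)

Section KernelCriterion.
Variables (R : realType) (G : groupType).

(** Rational combinations of the enumerated vectors form a countable set and approximate all real
    combinations, one term at a time. *)
Lemma countable_comb_separable (V : normedModType R) (I : Type) (u : I -> V)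
    (e : nat -> I) :
  (forall i, exists n, e n = i) -> approx_dense (range (comb u)) -> separable V.
Proof.
move=> e_surj du.
pose q_comb (q : seq (rat * nat)) := comb u [seq (ratr a.1, e a.2) | a <- q].
exists (range q_comb); split.
  by apply: card_le_trans (card_image_le _ _) _; exact: countableP.
have approx c (eps : R) : 0 < eps -> exists q, `|comb u c - q_comb q| <= eps.
  elim: c eps => [|[t i] c IH] eps eps0.
    by exists [::]; rewrite /q_comb subrr normr0 ltW.
  have [n en] := e_surj i.
  have eps20 : 0 < eps / 2 by rewrite divr_gt0.
  have [q cq] := IH _ eps20.
  have u0 : 0 < `|u i| + 1 by rewrite ltr_wpDl.
  pose d := eps / 2 / (`|u i| + 1).
  have d0 : 0 < d by rewrite divr_gt0.
  have [r] := rat_in_itvoo (ltr_pwDr d0 (lexx t)).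
  rewrite in_itv /= => /andP[tr rt].
  exists ((r, n) :: q).
  rewrite /q_comb /= -cat1s -(cat1s (ratr r, e n)) !comb_cat !comb1 en.
  rewrite opprD addrACA -scalerBl (le_trans (ler_normD _ _))// normrZ.
  rewrite ler0_norm ?subr_le0 ?(ltW tr)// opprB.
  have : (ratr r - t) * (`|u i| + 1) <= eps / 2.
    by rewrite -ler_pdivlMr // lerBlDl ltW.
  have : 0 <= ratr r - t by rewrite subr_ge0 ltW.
  move: cq; rewrite /q_comb; have := normr_ge0 (u i).
  by rewrite mulrDr mulr1; lra.
move=> O [x Ox] Oopen.
have /nbhs_ballP[eps /= eps0 xO] := open_nbhs_nbhs (conj Oopen Ox).
have eps30 : 0 < eps / 3 by rewrite divr_gt0.
have [_ [c _ <-] xc] := du x _ eps30.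
have [q cq] := approx c _ eps30.
exists (q_comb q); split; last by exists q.
apply: xO; rewrite -ball_normE /=.
have := ler_normD (x - comb u c) (comb u c - q_comb q); rewrite subrKA.
by lra.
Qed.

(* The image of [c] under the linear part [w h |-> w (gh) - w g] of the action. *)
Definition translate (g : G) (c : seq (R * G)) : seq (R * G) :=
  [seq (a.1, (g * a.2)%g) | a <- c] ++ [seq (- a.1, g) | a <- c].

Lemma comb_translate (V : lmodType R) (u : G -> V) g c :
  comb u (translate g c) = comb (fun h => u (g * h)%g - u g) c.
Proof.
rewrite comb_cat /comb !big_map -big_split; apply: eq_bigr => a _ /=.
by rewrite scalerBr scaleNr.
Qed.

(** [K 1 1 = 0] puts the vector of the identity at the origin, so that [w g] is the orbit of 0. The
    bound on [translate] yields the linear parts, and the finite sublevel sets of [K g g = |w g|^2]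
    yield properness. *)
Lemma aTmenable_of_kernel (K : psd_kernel R G) (L : R) (e : nat -> G) :
  (forall g, exists n, e n = g) -> 0 < L -> K 1%g 1%g = 0 ->
  (forall g c, knorm K (translate g c) <= L * knorm K c) ->
  (forall M, finite_set [set g | K g g <= M]) ->
  uniformly_bounded_aTmenable R G.
Proof.
move=> e_surj L0 K1 KL Kproper.
have [W [w [w_norm w_dense]]] := psd_kernel_realization K.
have w_knorm c : `|comb w c| = knorm K c.
  by rewrite /knorm -[kform _ _ _]w_norm sqrtr_sqr normr_id.
have w_kernel g : `|w g| ^+ 2 = K g g.
  have := w_norm [:: (1, g)]; rewrite !comb1 scale1r => ->.
  by rewrite ev1 scale1r mul1r.
have w1 : w 1%g = 0.
  by apply/eqP; rewrite -normr_eq0 -sqrf_eq0 w_kernel K1.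
have /choice[T TP] g : exists T : {linear W -> W},
    (forall h, T (w h) = w (g * h)%g - w g) /\ forall x, `|T x| <= L * `|x|.
  apply: bounded_linear_extension => // c.
  by rewrite -comb_translate !w_knorm.
have Tw g h : T g (w h) = w (g * h)%g - w g by exact: (TP g).1.
have TL g x : `|T g x| <= L * `|x| by exact: (TP g).2.
have T_ext (A B : {linear W -> W}) (M M' : R) :
    (forall x, `|A x| <= M * `|x|) -> (forall x, `|B x| <= M' * `|x|) ->
    (forall h, A (w h) = B (w h)) -> forall x, A x = B x.
  move=> AM BM' AB; apply: bounded_linear_eq w_dense AM BM' _ => _ [c _ <-].
  rewrite !linear_comb; apply: eq_bigr => a _ /=; congr (_ *: _); exact: AB.
have T1 x : T 1%g x = x.
  apply: (T_ext (T 1%g) idfun L 1) => // [y|h]; first by rewrite mul1r.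
  by rewrite Tw w1 subr0 mul1g.
have TM g h x : T (g * h)%g x = T g (T h x).
  apply: (T_ext (T (g * h)%g) (T g \o T h) L (L * L)) => // [y|k] /=.
    by rewrite (le_trans (TL _ _))// -mulrA ler_pM2l.
  by rewrite !Tw linearB /= !Tw mulgA opprB addrA subrK.
pose alpha g x := T g x + w g.
(* This is the cocycle identity [w (g * h) = T g (w h) + w g]. *)
have alphaM g h : alpha (g * h)%g = alpha g \o alpha h.
  apply/funext => x; rewrite /alpha /= linearD /= Tw TM -addrA subrK //.
have alpha1 x : alpha 1%g x = x by rewrite /alpha T1 w1 addr0.
have alpha_affine g : is_affine (alpha g) by exists (T g), (w g).
exists W, alpha; split.
- exact: countable_comb_separable e_surj w_dense.
- split=> // g; exists (alpha (g^-1)%g); split=> // x.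
    by rewrite -[LHS]/((alpha (g^-1)%g \o alpha g) x) -alphaM mulVg.
  by rewrite -[LHS]/((alpha g \o alpha (g^-1)%g) x) -alphaM mulgV.
- exists L => // g; rewrite /affine_norm (@linear_partE _ _ _ (T g) (w g)) //.
  by apply: op_norm_le => //; exact: ltW.
move=> B [M [_ BM]].
(* [bounded_set] gives a bound only for reals strictly above [M]. If [x] and [alpha g x] lie in [B],
   then [w g = alpha g x - T g x] has norm at most [M' + L * M']. *)
pose M' := M + 1.
have {}BM x : B x -> `|x| <= M' by apply: BM; rewrite ltrDl.
apply: sub_finite_set (Kproper ((M' + L * M') ^+ 2)).
move=> g [_ [[x Bx <-] /BM]] /=.
have := TL g x; have := BM x Bx; rewrite -w_kernel => xM Tx ax.
have : `|w g| <= `|alpha g x| + `|T g x|.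
  have -> : w g = alpha g x - T g x by rewrite /alpha [_ + w g]addrC addrK.
  exact: ler_normB.
move=> wle; have := normr_ge0 (w g); have := normr_ge0 x => x0 w0.
have wM : `|w g| <= M' + L * M' by have := ler_wpM2l (ltW L0) xM; lra.
by rewrite ler_sqr ?nnegrE // (le_trans w0).
Qed.

End KernelCriterion.

(** * Word length and cosets *)

Lemma minimizer_nat (T : Type) (f : T -> nat) (A : set T) :
  A !=set0 -> exists2 x, A x & forall y, A y -> (f x <= f y)%N.
Proof.
move=> [x0 Ax0].
have ex : exists n, `[< exists2 x, A x & f x = n >].
  by exists (f x0); apply/asboolP; exists x0.
have [n /asboolP[x Ax fx] n_min] := ex_minnP ex.
by exists x => // y Ay; rewrite fx n_min //; apply/asboolP; exists y.
Qed.

Lemma inf_natr_minimizer (R : realType) (T : Type) (f : T -> nat) (A : set T) x :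
  A x -> (forall y, A y -> (f x <= f y)%N) ->
  inf [set (f y)%:R | y in A] = (f x)%:R :> R.
Proof.
move=> Ax f_min; apply/le_anti/andP; split.
  by apply: ge_inf; [exists 0 => _ [y _ <-]|exists x].
apply: lb_le_inf; first by exists (f x)%:R, x.
by move=> _ [y Ay <-]; rewrite ler_nat f_min.
Qed.

Lemma finite_set_bounded (R : realType) (T : Type) (f : T -> R) (A : set T) :
  finite_set A -> exists C : R, 0 <= C /\ forall x, A x -> f x <= C.
Proof.
move=> /(finite_image f)/finite_seqP[s sE].
suff [C [C0 sC]] : exists C : R, 0 <= C /\ forall y, y \in s -> y <= C.
  exists C; split=> // x Ax; apply: sC.
  by have : (f @` A) (f x) by [exists x]; rewrite sE.
elim: s {sE} => [|z s [C [C0 sC]]]; first by exists 0.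
exists (Num.max C z); split; first by rewrite le_max C0.
move=> y; rewrite inE le_max => /orP[/eqP ->|/sC ->//].
by rewrite lexx orbT.
Qed.

(** * Word length as a natural number *)

Section WordLength.
Variables (G : groupType) (S : set G).
Hypothesis S_gen : finite_symmetric_generating S.

(** The default [[::]] is never reached when [S] generates: a shortest word then exists. *)
Definition wordlen (g : G) : nat := size (xget [::] [set w | words S g w /\
  forall w', words S g w' -> (size w <= size w')%N]).

Lemma wordlenP g : exists2 w, words S g w & size w = wordlen g.
Proof.
have [_ _ /(_ g)/(minimizer_nat size)[w gw wmin]] := S_gen.
rewrite /wordlen; case: xgetP => [w' _ [gw' _]|/(_ w)]; first by exists w'.
by case.
Qed.

Lemma wordlen_min g w : words S g w -> (wordlen g <= size w)%N.
Proof.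
move=> gw; have [_ _ /(_ g)/(minimizer_nat size)[v gv vmin]] := S_gen.
rewrite /wordlen; case: xgetP => [w' _ [_ ->]//|/(_ v)].
by case.
Qed.

Lemma word_lengthE (R : realType) g : word_length R S g = (wordlen g)%:R.
Proof.
have [w gw wE] := wordlenP g.
rewrite /word_length (@inf_natr_minimizer R _ size _ w) => [||v gv]; rewrite ?wE //.
exact: wordlen_min.
Qed.

Lemma wordlen1 : wordlen 1%g = 0%N.
Proof.
by apply/eqP; rewrite -leqn0 (@wordlen_min _ [::])//; split; rewrite ?big_nil.
Qed.

Lemma wordlen_eq0 g : wordlen g = 0%N -> g = 1%g.
Proof.
by have [w [_ <-] <-] := wordlenP g => /size0nil ->; rewrite big_nil.
Qed.

Lemma wordlenM g h : (wordlen (g * h)%g <= wordlen g + wordlen h)%N.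
Proof.
have [w [wS <-] <-] := wordlenP g; have [v [vS <-] <-] := wordlenP h.
rewrite -size_cat wordlen_min//; split; last by rewrite big_cat.
by move=> s; rewrite mem_cat => /orP[/wS|/vS].
Qed.

Lemma wordlenV_le g : (wordlen (g^-1)%g <= wordlen g)%N.
Proof.
have [_ SV _] := S_gen.
have [w [wS <-] <-] := wordlenP g.
rewrite -(size_map (fun s => s^-1)%g) -size_rev wordlen_min//; split.
  by move=> s; rewrite mem_rev => /mapP[t /wS St ->]; exact: SV.
elim: w {wS} => [|s w IH]; first by rewrite !big_nil invg1.
by rewrite /= rev_cons -cats1 big_cat /= IH big_seq1 big_cons invgM.
Qed.

Lemma wordlenV g : wordlen (g^-1)%g = wordlen g.
Proof.
by apply/anti_leq; rewrite wordlenV_le -{1}[g]invgK wordlenV_le.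
Qed.

Lemma finite_wordlen_ball n : finite_set [set g | (wordlen g <= n)%N].
Proof.
have [S_fin _ _] := S_gen.
elim: n => [|n IH].
  by apply: sub_finite_set (finite_set1 1%g) => g /=; rewrite leqn0 => /eqP/wordlen_eq0.
have fin : finite_set ([set 1%g] `|`
    [set (s * h)%g | s in S & h in [set h | (wordlen h <= n)%N]]).
  rewrite finite_setU; split; first exact: finite_set1.
  exact: (finite_image2 (fun s h => s * h)%g S_fin IH).
apply: sub_finite_set fin => g /=.
have [[|s w] [wS <-] <-] := wordlenP g => wn.
  by left; rewrite big_nil.
right; exists s; first by apply: wS; rewrite mem_head.
exists (\prod_(s <- w) s)%g; last by rewrite big_cons.
rewrite /= -ltnS; apply: leq_trans wn; rewrite ltnS; apply: wordlen_min; split=> // t tw.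
by apply: wS; rewrite inE tw orbT.
Qed.

(** A finitely generated group is countable: a natural number decodes to a list of positions in an
    enumeration of [S], hence to a word. *)
Lemma enumerate_group : exists e : nat -> G, forall g, exists n, e n = g.
Proof.
have [/finite_seqP[s sE] _ words0] := S_gen.
exists (fun n => \prod_(i <- odflt [::] (@unpickle (seq nat) n)) nth 1 s i)%g.
move=> g; have [w [wS <-]] := words0 g.
exists (pickle [seq index x s | x <- w]); rewrite pickleK /= big_map.
rewrite !big_seq; apply: eq_bigr => x /wS; rewrite sE /= => xs.
by rewrite nth_index.
Qed.

End WordLength.

(** * Cosets and the quotient metric *)

Section Cosets.
Variables (R : realType) (G : groupType) (S : set G) (N : set G).
Hypotheses (S_gen : finite_symmetric_generating S) (N_normal : normal_subgroup N).
Local Notation len := (wordlen S).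

Lemma normal_subgroup1 : N 1%g.
Proof. by have [[N1 _] _] := N_normal; move: N1; rewrite !inE. Qed.

Lemma normal_subgroupM g h : N g -> N h -> N (g * h)%g.
Proof.
by have [/group_closedM NM _] := N_normal => Ng Nh; have := NM g h; rewrite !inE; apply.
Qed.

Lemma normal_subgroupV g : N g -> N (g^-1)%g.
Proof.
by have [/group_closedV NV _] := N_normal => Ng; have := NV g; rewrite !inE; apply.
Qed.

Lemma normal_subgroupJ g h : N g -> N (g ^ h)%g.
Proof. by have [_ NJ] := N_normal; exact: NJ. Qed.

Lemma left_coset_eq g h : N (g^-1 * h)%g -> left_coset N g = left_coset N h.
Proof.
move=> Ngh; apply/seteqP; split=> _ [n Nn <-].
  exists ((g^-1 * h)^-1 * n)%g; last by rewrite invgM invgK !mulgA mulgV mul1g.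
  exact/normal_subgroupM/Nn/normal_subgroupV.
exists (g^-1 * h * n)%g; last by rewrite !mulgA mulgV mul1g.
exact: normal_subgroupM.
Qed.

Lemma left_coset_self g : left_coset N g g.
Proof. by exists 1%g; rewrite ?mulg1//; exact: normal_subgroup1. Qed.

(** By normality a change of representative of the first coset can be moved past [g^-1 * h], so
    minimizing over pairs is minimizing over one element of [N]. *)
Lemma quotient_dist_attained g h :
  exists2 n, N n &
    quotient_dist R S (left_coset N g) (left_coset N h) = (len (g^-1 * h * n)%g)%:R /\
    forall n', N n' -> (len (g^-1 * h * n)%g <= len (g^-1 * h * n')%g)%N.
Proof.
rewrite /quotient_dist.
have AB0 : left_coset N g `*` left_coset N h !=set0.
  by exists (g, h); split; exact: left_coset_self.
have [[_ _] [/= [m Nm <-] [n Nn <-]] mn_min] :=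
  minimizer_nat (fun p : G * G => len (p.1^-1 * p.2)%g) AB0.
rewrite (_ : (fun p : G * G => word_dist R S p.1 p.2) =
             fun p => (len (p.1^-1 * p.2)%g)%:R); last first.
  by apply/funext => p; rewrite /word_dist word_lengthE.
rewrite (@inf_natr_minimizer _ _ _ _ (g * m, h * n)%g) //=; last first.
  by split; [exists m|exists n].
have shift : ((g * m)^-1 * (h * n))%g = (g^-1 * h * ((m^-1 ^ (g^-1 * h)) * n))%g.
  by rewrite conjgE !invgM !invgK -!mulgA mulVKg mulKg.
exists ((m^-1 ^ (g^-1 * h)) * n)%g.
  by apply/normal_subgroupM/Nn/normal_subgroupJ/normal_subgroupV.
rewrite /= shift; split=> // n' Nn'; rewrite -shift.
rewrite -[leqRHS]/(len _) -(mulgA (g^-1)%g h n').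
apply: (mn_min (g, h * n')%g).
by split; [exact: left_coset_self|exists n'].
Qed.

End Cosets.

(** * Ultralimits of averaged kernels *)

(** Compactness of [[- M, M]] gives a cluster point, and an ultrafilter converges to its cluster
    points. *)
Lemma ultra_bounded_cvg (R : realType) (T : Type) (U : set_system T)
    (f : T -> R) (M : R) :
  UltraFilter U -> U [set t | `|f t| <= M] -> cvg (f @ U).
Proof.
move=> UU fM.
have fMU : (f @ U) `[- M, M]%classic.
  change (U (f @^-1` `[- M, M]%classic)); apply: filterS fM => t /= ft.
  by rewrite in_itv /= -ler_norml.
have [p [_ clp]] := @segment_compact R (- M) M (f @ U) _ fMU.
apply/cvg_ex; exists p => V pV.
have [//|UnV] := in_ultra_setVsetC (f @^-1` V) UU.
by have [y []] := clp (~` V) V UnV pV.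
Qed.

(** * Averages over a finite quotient *)

Section CosetMean.
Variables (R : realType) (G : groupType) (N : set G).
Hypotheses (N_normal : normal_subgroup N) (N_index : finite_index N).

Definition coset_rep (A : set G) : G := xget 1%g A.

(** The average over G/N, defined for every function on [G] through chosen representatives; the
    choice does not matter when [F] is constant on left cosets. *)
Definition coset_mean (F : G -> R) : R :=
  (#|` fset_set (left_cosets N)|%:R)^-1 *
  \sum_(A <- fset_set (left_cosets N)) F (coset_rep A).

Lemma coset_mean_linear : linear_for *%R coset_mean.
Proof.
move=> t F F'; rewrite /coset_mean [t * _]mulrCA -mulrDr; congr (_ * _).
by rewrite mulr_sumr -big_split; apply: eq_bigr.
Qed.

HB.instance Definition _ :=
  GRing.isLinear.Build R (G -> R) R^o *:%R coset_mean coset_mean_linear.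

Lemma coset_mean_le F F' : (forall x, F x <= F' x) -> coset_mean F <= coset_mean F'.
Proof.
move=> FF'; rewrite ler_wpM2l ?invr_ge0 ?ler0n //.
by apply: ler_sum => A _.
Qed.

Lemma coset_mean_cst t : coset_mean (fun=> t) = t.
Proof.
rewrite /coset_mean big_const_seq count_predT iter_addr_0.
rewrite -[t *+ _]mulr_natl mulrA mulVf ?mul1r//.
rewrite pnatr_eq0 cardfs_eq0; apply/negP => /eqP/fsetP/(_ (left_coset N 1%g)).
rewrite in_fset_set // inE => /negP; apply.
by apply/mem_set; exists 1%g.
Qed.

Lemma coset_mean_norm_le F M :
  (forall x, `|F x| <= M) -> `|coset_mean F| <= M.
Proof.
move=> FM; rewrite ler_norml -{1}(coset_mean_cst (- M)) -{2}(coset_mean_cst M).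
by rewrite !coset_mean_le // => x; have := FM x; rewrite ler_norml => /andP[].
Qed.

Lemma left_coset_shift y g :
  [set (x * g)%g | x in left_coset N y] = left_coset N (y * g)%g.
Proof.
apply/seteqP; split=> [_ [_ [n Nn <-] <-]|_ [n Nn <-]].
  exists (n ^ g)%g; first exact: normal_subgroupJ.
  by rewrite conjgE !mulgA mulgK.
exists (y * n ^ (g^-1))%g; last by rewrite conjgE invgK !mulgA mulgVK.
by exists (n ^ (g^-1))%g => //; exact: normal_subgroupJ.
Qed.

Lemma coset_rep_spec y : exists2 n, N n & coset_rep (left_coset N y) = (y * n)%g.
Proof.
rewrite /coset_rep; case: xgetP => [_ _ [n Nn <-]|/(_ y)]; first by exists n.
by case; exact: left_coset_self.
Qed.

(** By normality right translation by [g] permutes the left cosets. It moves a representative of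
    [y N] to one of [y g N], where the invariant [F] takes the same value as at the chosen one. *)
Lemma coset_mean_shift F g : (forall x n, N n -> F (x * n)%g = F x) ->
  coset_mean (fun x => F (x * g)%g) = coset_mean F.
Proof.
move=> FN; rewrite /coset_mean; congr (_ * _).
rewrite -!fsbig_finite //; pose h (A : set G) := [set (x * g)%g | x in A].
rewrite [RHS](reindex_fsbig h (left_cosets N)); last first.
  split=> [_ [y _ <-]|_ _ /set_mem[y _ <-] /set_mem[z _ <-]|_ [y _ <-]].
  - by rewrite /h left_coset_shift; exists (y * g)%g.
  - rewrite /h !left_coset_shift => yz.
    have : [set (x * g^-1)%g | x in left_coset N (y * g)%g] =
           [set (x * g^-1)%g | x in left_coset N (z * g)%g] by rewrite yz.
    by rewrite !left_coset_shift !mulgK.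
  - exists (left_coset N (y * g^-1)%g); first by exists (y * g^-1)%g.
    by rewrite /h left_coset_shift mulgVK.
apply: eq_fsbigr => _ /set_mem[y _ <-]; rewrite /h left_coset_shift.
have [n Nn ->] := coset_rep_spec y; have [n' Nn' ->] := coset_rep_spec (y * g)%g.
rewrite [RHS]FN // -(FN (y * g)%g (n ^ g)%g); last exact: normal_subgroupJ.
by rewrite conjgE !mulgA mulgK.
Qed.

End CosetMean.

(** * Limits of kernels and Gram forms *)

Section KernelLimit.
Variables (R : realType) (I : Type).

Lemma ev_cvg (T : Type) (U : set_system T) (f : T -> I -> R) (g : I -> R) c :
  Filter U -> (forall i, f t i @[t --> U] --> g i) -> ev (f t) c @[t --> U] --> ev g c.
Proof.
move=> FU fg; elim: c => [|[s i] c IH].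
  rewrite /ev /comb big_nil; under eq_fun do rewrite big_nil.
  exact: cvg_cst.
rewrite -cat1s ev_cat ev1; under eq_fun do rewrite -cat1s ev_cat ev1.
by apply: cvgD => //; apply: cvgMr.
Qed.

Lemma comb_fctE (K : I -> (I -> R)) c i : comb K c i = ev (K^~ i) c.
Proof. by rewrite /ev /comb fct_sumE. Qed.

Lemma kernel_form_cvg (T : Type) (U : set_system T) (K : T -> I -> I -> R)
    (K' : I -> I -> R) c d :
  Filter U -> (forall i j, K t i j @[t --> U] --> K' i j) ->
  ev (comb (K t : I -> (I -> R)) c) d @[t --> U] -->
  ev (comb (K' : I -> (I -> R)) c) d.
Proof.
move=> FU KK'; apply: ev_cvg => i; rewrite comb_fctE.
by under eq_fun do rewrite comb_fctE; apply: ev_cvg => j.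
Qed.

Lemma linear_ev (E : lmodType R) (T : {linear E -> R^o}) (u : I -> E) c :
  T (comb u c) = ev (T \o u) c.
Proof. exact: linear_comb. Qed.

Definition hdot (H : hilbertType R) (x y : H) : R := hilbert_dot H x y.

Lemma gram_form (H : hilbertType R) (u : I -> H) c d :
  ev (comb ((fun i j => hdot (u i) (u j)) : I -> (I -> R)) c) d =
  hdot (comb u c) (comb u d).
Proof.
rewrite /hdot /ev /comb linear_sumr; apply: eq_bigr => b _.
rewrite linearZr_LR fct_sumE /=; congr (_ * _).
by rewrite linear_sumlz; apply: eq_bigr => a _; rewrite linearZl_LR.
Qed.

Lemma hdotC (H : hilbertType R) (x y : H) : hdot x y = hdot y x.
Proof.
by rewrite /hdot (@hermitian_subproof _ _ _ _ (hilbert_dot H)) expr0 mul1r.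
Qed.

Lemma hdotDD (H : hilbertType R) (x y : H) :
  hdot (x + y) (x + y) = hdot x x + 2 * hdot x y + hdot y y.
Proof.
have -> : hdot (x + y) (x + y) = hdot x x + hdot x y + (hdot y x + hdot y y).
  by rewrite /hdot linearDl !linearDr.
by rewrite (hdotC y x); lra.
Qed.

(** A crude form of Cauchy-Schwarz, from [|x + y|^2 >= 0] and [|x - y|^2 >= 0]; it bounds the
    averaged kernels. *)
Lemma hdot_bound (H : hilbertType R) (x y : H) :
  `|hdot x y| <= `|x| ^+ 2 + `|y| ^+ 2.
Proof.
have hdotN z : hdot x (- z) = - hdot x z by exact: linearNr.
have hdotNN : hdot (- y) (- y) = hdot y y by rewrite /hdot !hilbert_dotE normrN.
have := sqr_ge0 `|x + y|; have := sqr_ge0 `|x - y|.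
have := sqr_ge0 `|x|; have := sqr_ge0 `|y|.
rewrite -!hilbert_dotE -!/(hdot _ _) !hdotDD hdotN hdotNN => y0 x0 xy1 xy2.
by rewrite ler_norml; apply/andP; split; lra.
Qed.

End KernelLimit.

(** * The ultralimit of the averaged kernels *)

Section AveragedKernel.
Variables (R : realType) (G : groupType).

Lemma coset_mean_gram (N : set G) (H : hilbertType R) (u : G -> G -> H) c d :
  ev (comb ((fun g h => coset_mean N (fun x => hdot (u g x) (u h x)))
            : G -> (G -> R)) c) d =
  coset_mean N (fun x => hdot (comb (u^~ x) c) (comb (u^~ x) d)).
Proof.
pose F g h : G -> R := fun x => hdot (u g x) (u h x).
have -> : comb ((fun g h => coset_mean N (F g h)) : G -> (G -> R)) c =
    coset_mean N \o (fun h => comb (F^~ h) c).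
  by apply/funext => h; rewrite comb_fctE /= linear_ev.
rewrite -linear_ev; congr (coset_mean N _); apply/funext => x.
rewrite -gram_form !comb_fctE /=; congr (ev _ _); apply/funext => h.
by rewrite !comb_fctE.
Qed.

(** The shift estimate compares values at [x] with values at [x * g]. Averaging over the quotient
    removes this displacement, and the limit over [r] turns estimates valid only for large [r] into
    estimates for all [g] and [c]. *)
Lemma aTmenable_of_averages (S : set G) (N : nat -> set G) (H : hilbertType R)
    (v : nat -> G -> G -> H) (L : R) :
  finite_symmetric_generating S ->
  (forall r, normal_subgroup (N r)) -> (forall r, finite_index (N r)) -> 0 < L ->
  (forall r g x n, N r n -> v r g (x * n)%g = v r g x) ->
  (forall r x, v r 1%g x = 0) ->
  (forall g, exists M, \forall r \near \oo, forall x, `|v r g x| <= M) ->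
  (forall M, exists m, forall g, (m < wordlen S g)%N ->
     \forall r \near \oo, forall x, M <= `|v r g x|) ->
  (forall g c, \forall r \near \oo, forall x,
     `|comb (fun h => v r h x) (translate g c)| <=
     L * `|comb (fun h => v r h (x * g)%g) c|) ->
  uniformly_bounded_aTmenable R G.
Proof.
move=> S_gen N_normal N_index L0 vN v1 v_bd v_proper v_shift.
(* A single ultrafilter refining the tails makes all entries converge at once, without extracting
   subsequences. *)
have [U [UU ooU]] := ultraFilterLemma (eventually_filter : ProperFilter \oo).
pose K_ r g h := coset_mean (N r) (fun x => hdot (v r g x) (v r h x)).
have K_cvg g h : cvg (K_ r g h @[r --> U]).
  have [[M gM] [M' hM]] := (v_bd g, v_bd h).
  apply: (@ultra_bounded_cvg _ _ _ _ (M ^+ 2 + M' ^+ 2)).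
  apply: ooU; near=> r; apply: coset_mean_norm_le => // x.
  have xM y : `|v r g y| <= M by move: y; near: r.
  have xM' y : `|v r h y| <= M' by move: y; near: r.
  apply: le_trans (hdot_bound _ _) _.
  by rewrite lerD // ler_sqr ?nnegrE ?(le_trans _ (xM x)) ?(le_trans _ (xM' x)).
pose K g h := lim (K_ r g h @[r --> U]).
have form_cvg c d : coset_mean (N r) (fun x =>
      hdot (comb (v r ^~ x) c) (comb (v r ^~ x) d)) @[r --> U] -->
    ev (comb (K : G -> (G -> R)) c) d.
  under eq_fun do rewrite -coset_mean_gram.
  exact: (@kernel_form_cvg _ _ _ U K_ K).
have sqr_cvg c : coset_mean (N r) (fun x => `|comb (v r ^~ x) c| ^+ 2) @[r --> U] -->
    ev (comb (K : G -> (G -> R)) c) c.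
  have := form_cvg c c; under eq_fun do under eq_fun do rewrite /hdot hilbert_dotE.
  exact.
have K_sym g h : K g h = K h g.
  by congr (lim (_ @ U)); apply/funext => r; congr coset_mean; apply/funext => x;
    rewrite hdotC.
have K_psd c : 0 <= ev (comb (K : G -> (G -> R)) c) c.
  rewrite -(cvg_lim _ (sqr_cvg c)) //; apply: limr_ge.
    by apply/cvg_ex; eexists; exact: sqr_cvg.
  near=> r; rewrite -(coset_mean_cst (N_index r) 0).
  by apply: coset_mean_le => x; exact: sqr_ge0.
have K_diag g : coset_mean (N r) (fun x => `|v r g x| ^+ 2) @[r --> U] --> K g g.
  have := sqr_cvg [:: (1, g)]; rewrite ev1 mul1r comb1 scale1r.
  by under eq_fun do under eq_fun do rewrite comb1 scale1r.
pose KK := PsdKernel K_sym K_psd.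
have [e e_surj] := enumerate_group S_gen.
apply: (@aTmenable_of_kernel _ _ KK L e) => //.
- have := K_diag 1%g; rewrite (_ : (fun r => _) = fun=> 0); last first.
    apply/funext => r; rewrite -[RHS](coset_mean_cst (N_index r)).
    by congr coset_mean; apply/funext => x; rewrite v1 normr0 expr0n.
  by move/(cvg_lim (@Rhausdorff R)); rewrite lim_cst.
- move=> g c; rewrite -ler_sqr ?nnegrE ?mulr_ge0 ?knorm_ge0 ?(ltW L0) //.
  rewrite exprMn !sqr_knorm.
  have cvl := sqr_cvg (translate g c).
  have cvr : L ^+ 2 * coset_mean (N r) (fun x => `|comb (v r ^~ x) c| ^+ 2) @[r --> U] -->
      L ^+ 2 * kform KK c c by apply: cvgMr; exact: sqr_cvg.
  apply: (ler_cvg_to cvl cvr).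
  apply: ooU; near=> r.
  have shift x : `|comb (v r ^~ x) (translate g c)| <= L * `|comb (v r ^~ (x * g)%g) c|.
    by move: x; near: r.
  (* The mean on the right is replaced by the mean of its translate by [g], so that the estimate
     applies at each [x]. *)
  rewrite -[X in _ <= _ * X](@coset_mean_shift _ _ _ (N_normal r) (N_index r) _ g);
    last first.
    by move=> x n Nn; congr (`|comb _ c| ^+ 2); apply/funext => h; rewrite vN.
  rewrite -[leRHS]linearZ_LR; apply: coset_mean_le => x /=.
  rewrite -[leRHS]/(L ^+ 2 * _) -exprMn ler_sqr ?nnegrE ?mulr_ge0 ?(ltW L0) //.
(* [M] may be negative; [(|M| + 1) ^+ 2] exceeds it strictly, which excludes every [g] of length
   above [m] from the sublevel set. *)
- move=> M; have [m mP] := v_proper (`|M| + 1).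
  apply: sub_finite_set (finite_wordlen_ball S_gen m) => g /=.
  apply: contraTT; rewrite -!ltnNge -ltNge => gm.
  have M0 : 0 <= `|M| + 1 by rewrite addr_ge0.
  apply: (@lt_le_trans _ _ ((`|M| + 1) ^+ 2)).
    by have := ler_norm M; have := normr_ge0 M; rewrite expr2; nra.
  apply: (ler_cvg_to (cvg_cst _) (K_diag g)).
  apply: ooU; near=> r.
  rewrite -{1}(coset_mean_cst (N_index r) ((`|M| + 1) ^+ 2)).
  apply: coset_mean_le => x.
  have : `|M| + 1 <= `|v r g x| by move: x; near: r; exact: mP.
  by move=> Mv; rewrite ler_sqr // nnegrE.
Unshelve. all: by end_near. Qed.

End AveragedKernel.

(** * Box spaces *)

Section BoxSpace.
Variables (R : realType) (G : groupType) (S : set G) (N : nat -> set G).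
Variables (X : metricType R) (iota : forall i : nat, left_cosets (N i) -> X).
Hypotheses (S_gen : finite_symmetric_generating S).
Hypotheses (N_normal : forall i, normal_subgroup (N i)).
Hypotheses (N_index : forall i, finite_index (N i)).
Hypotheses (N_decr : forall i, N i.+1 `<=` N i).
Hypotheses (N_cap : \bigcap_i N i = [set 1%g]).
Hypotheses (X_box : box_space S iota).
Local Notation len := (wordlen S).

Definition coset_elt i g : left_cosets (N i) :=
  SigSub (mem_set (ex_intro2 _ _ g I erefl : left_cosets (N i) (left_coset (N i) g))).

Definition box_pt i g : X := iota (coset_elt i g).

Lemma box_pt_surj x : exists i g, x = box_pt i g.
Proof.
have [[f fK Kf] _ _] := X_box.
have xE := Kf x; case: (f x) xE => i [A /= AN] <-.
have [g _ gA] := set_mem AN; exists i, g.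
by congr iota; exact: val_inj.
Qed.

Lemma box_pt_dist i g h : mdist (box_pt i g) (box_pt i h) =
  quotient_dist R S (left_coset (N i) g) (left_coset (N i) h).
Proof. by have [_ ->] := X_box. Qed.

Lemma box_pt_far i j g h : i <> j -> (i + j)%:R <= mdist (box_pt i g) (box_pt j h).
Proof. by have [_ _] := X_box; exact. Qed.

Lemma box_pt_coset i g h : N i (g^-1 * h)%g -> box_pt i g = box_pt i h.
Proof.
by move=> Ngh; congr iota; apply: val_inj => /=; exact: left_coset_eq.
Qed.

Lemma box_pt_index i j g h : box_pt i g = box_pt j h -> i = j.
Proof.
move=> gh; apply: contrapT => ij.
have := box_pt_far g h ij; rewrite gh mdistxx (ler_nat _ _ 0) leqn0 addn_eq0.
by case/andP=> /eqP i0 /eqP j0; apply: ij; rewrite i0 j0.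
Qed.

Lemma finite_box_layer i : finite_set (range (box_pt i)).
Proof.
pose f (A : set G) : X := box_pt i (xget 1%g A).
apply: sub_finite_set (finite_image f (N_index i)) => _ [g _ <-].
exists (left_coset (N i) g); first by exists g.
rewrite /f; case: xgetP => [_ _ [n Nn <-]|/(_ g)]; last first.
  by case; exact: left_coset_self.
by apply/esym/box_pt_coset; rewrite mulgA mulVg mul1g.
Qed.

Lemma box_pt_dist_attained i g h : exists2 n, N i n &
  mdist (box_pt i g) (box_pt i h) = (len (g^-1 * h * n)%g)%:R /\
  forall n', N i n' -> (len (g^-1 * h * n)%g <= len (g^-1 * h * n')%g)%N.
Proof.
by rewrite box_pt_dist; exact: (quotient_dist_attained R S_gen (N_normal i)).
Qed.

Lemma box_pt_dist_le i g h : mdist (box_pt i g) (box_pt i h) <= (len (g^-1 * h)%g)%:R.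
Proof.
have [n _ [-> /(_ 1%g)]] := box_pt_dist_attained i g h.
by rewrite mulg1 ler_nat; apply; exact: normal_subgroup1.
Qed.

(** A minimizing [n] is the quotient of two elements of length at most that of [g^-1 * h], hence has
    at most twice this length. *)
Lemma box_pt_dist_eq i g h :
  (forall n, N i n -> (len n <= 2 * len (g^-1 * h)%g)%N -> n = 1%g) ->
  mdist (box_pt i g) (box_pt i h) = (len (g^-1 * h)%g)%:R.
Proof.
move=> small; have [n Nn [-> n_min]] := box_pt_dist_attained i g h.
suff -> : n = 1%g by rewrite mulg1.
apply: small => //; rewrite -{1}[n](mulKg (g^-1 * h)%g).
apply: leq_trans (wordlenM S_gen _ _) _; rewrite wordlenV // mul2n -addnn leq_add2l.
by have := n_min 1%g; rewrite mulg1; apply; exact: normal_subgroup1.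
Qed.

Lemma box_pt_inj i g h : box_pt i g = box_pt i h -> N i (g^-1 * h)%g.
Proof.
move=> gh; have [n Nn [/esym/eqP + _]] := box_pt_dist_attained i g h.
rewrite gh mdistxx pnatr_eq0 => /eqP/(wordlen_eq0 S_gen) ghn.
rewrite -[(g^-1 * h)%g](mulgK n) ghn mul1g.
exact: normal_subgroupV.
Qed.

Lemma box_pt_mulr i x y g : box_pt i x = box_pt i y ->
  box_pt i (x * g)%g = box_pt i (y * g)%g.
Proof.
move=> /box_pt_inj xy; apply: box_pt_coset.
have := normal_subgroupJ (N_normal i) g xy.
by rewrite conjgE !invgM !mulgA.
Qed.

(** * Short elements of the subgroups and isometric lifts *)

Lemma chain_decr i j : (i <= j)%N -> N j `<=` N i.
Proof.
move=> /subnK <-; elim: (j - i)%N => // k IH; rewrite addSn.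
by apply: subset_trans IH; exact: N_decr.
Qed.

(** There are finitely many elements of length at most [m]; each nontrivial one leaves the chain at
    some stage and, the chain being decreasing, for good. *)
Lemma short_elements_trivial m :
  exists M, forall i n, (M <= i)%N -> N i n -> (len n <= m)%N -> n = 1%g.
Proof.
have /finite_seqP[s sE] := finite_wordlen_ball S_gen m.
suff [M MP] : exists M, forall g, g \in s -> N M g -> g = 1%g.
  exists M => i n Mi Nn nm; apply: MP; last exact: chain_decr Mi _ Nn.
  by have : [set` s] n by rewrite -sE.
elim: s {sE} => [|g s [M MP]]; first by exists 0%N.
have [->|g1] := eqVneq g 1%g.
  by exists M => h; rewrite inE => /orP[/eqP->//|/MP]; exact.
have [k Nkg] : exists k, ~ N k g.
  apply/existsNP => Ng; move/eqP: g1; apply.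
  by have : (\bigcap_i N i) g by []; rewrite N_cap.
exists (maxn M k) => h; rewrite inE => /orP[/eqP->|hs] Nh.
  by case: Nkg; apply: chain_decr Nh; exact: leq_maxr.
by apply: MP hs _; apply: chain_decr Nh; exact: leq_maxl.
Qed.

(** Points of distinct layers beyond [M] are at least [m] apart, so [C] lies in one layer. Each
    point is lifted to a representative realizing its distance to a base point [g0]. Two lifts are
    then within [2 * m], and the element correcting them to the quotient distance has length at most
    [3 * m], hence is trivial. *)
Lemma box_lift (m M : nat) (C : set X) :
  (forall i n, (M <= i)%N -> N i n -> (len n <= 3 * m)%N -> n = 1%g) ->
  (m <= M)%N -> (forall i g, C (box_pt i g) -> (M <= i)%N) ->
  (forall x y, C x -> C y -> mdist x y < m%:R) ->
  exists lift : X -> G, exists2 i, (M <= i)%N &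
    (forall x, C x -> x = box_pt i (lift x)) /\
    forall x y, C x -> C y -> mdist x y = (len ((lift x)^-1 * lift y)%g)%:R.
Proof.
move=> small mM CM Cm.
have [[x0 Cx0]|C0] := pselect (C !=set0); last first.
  by exists (fun=> 1%g), M => //; split=> x; move=> *; case: C0; exists x.
have [i [g0 x0E]] := box_pt_surj x0.
have Mi : (M <= i)%N by apply: (CM i g0); rewrite -x0E.
have /choice[lift liftP] x : exists h, C x ->
    x = box_pt i h /\ mdist x0 x = (len (g0^-1 * h)%g)%:R.
  have [Cx|nCx] := pselect (C x); last by exists 1%g.
  have [j [g xE]] := box_pt_surj x.
  have Mj : (M <= j)%N by apply: (CM j g); rewrite -xE.
  have ij : i = j.
    apply: contrapT => /(box_pt_far g0 g); rewrite -x0E -xE leNgt => /negP; apply.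
    apply: lt_le_trans (Cm _ _ Cx0 Cx) _; rewrite ler_nat.
    exact: leq_trans (leq_trans mM Mi) (leq_addr _ _).
  subst j; have [n Nn [dn _]] := box_pt_dist_attained i g0 g.
  exists (g * n)%g => _; rewrite mulgA -dn -x0E -xE; split=> //.
  by rewrite {1}xE; apply: box_pt_coset; rewrite mulKg.
exists lift, i => //; split=> [x /liftP[]//|x y Cx Cy].
have [[xE dx] [yE dy]] := (liftP _ Cx, liftP _ Cy).
have [n Nn [dn _]] := box_pt_dist_attained i (lift x) (lift y).
have short z : C z -> mdist x0 z = (len (g0^-1 * lift z)%g)%:R ->
    (len (g0^-1 * lift z)%g <= m)%N.
  by move=> Cz dz; have := Cm _ _ Cx0 Cz; rewrite dz ltr_nat => /ltnW.
rewrite -xE -yE in dn; rewrite dn (small i n) ?mulg1 //.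
rewrite -[n](mulKg ((lift x)^-1 * lift y)%g).
have unm : (len ((lift x)^-1 * lift y * n)%g <= m)%N.
  by have := Cm _ _ Cx Cy; rewrite dn ltr_nat => /ltnW.
apply: leq_trans (wordlenM S_gen _ _) _; rewrite wordlenV //.
rewrite (mulSn 2) addnC leq_add // mul2n -addnn.
have -> : ((lift x)^-1 * lift y)%g = ((g0^-1 * lift x)^-1 * (g0^-1 * lift y))%g.
  by rewrite invgM invgK !mulgA mulgK.
by rewrite (leq_trans (wordlenM S_gen _ _))// wordlenV // leq_add // short.
Qed.

(** The elements [a^-1 * c] and [b^-1 * d] agree modulo [N i] and are short, so they are equal.
    Hence the left translation between two lifts is the same at every common point. *)
Lemma box_lift_transition (m i : nat) a b c d :
  (forall n, N i n -> (len n <= 3 * m)%N -> n = 1%g) ->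
  box_pt i a = box_pt i b -> box_pt i c = box_pt i d ->
  (len (a^-1 * c)%g <= m)%N -> (len (b^-1 * d)%g <= m)%N ->
  (c * d^-1)%g = (a * b^-1)%g.
Proof.
move=> small /box_pt_inj ab /box_pt_inj cd acm bdm.
have Nab : N i (a * b^-1)%g.
  have := normal_subgroupV (N_normal i) (normal_subgroupJ (N_normal i) (a^-1)%g ab).
  by rewrite conjgE !invgM !invgK !mulgA mulgK.
have E : ((a^-1 * c)^-1 * (b^-1 * d))%g = ((c^-1 * d) * (a * b^-1) ^ d)%g.
  by rewrite conjgE !invgM !invgK !mulgA mulgK.
have : ((a^-1 * c)^-1 * (b^-1 * d))%g = 1%g.
  apply: small.
    rewrite E; apply: normal_subgroupM => //; exact: normal_subgroupJ.
  rewrite (leq_trans (wordlenM S_gen _ _))// wordlenV //.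
  by rewrite mulSn mulSn mul1n leq_add // (leq_trans bdm) // leq_addr.
move=> /(congr1 (fun x => a * (a^-1 * c * x) * d^-1)%g).
by rewrite mulVKg mulg1 mulVKg mulgA mulgK => ->.
Qed.

(** * From an action to a fibred embedding *)

Lemma diameter_le (C : set X) (M : R) :
  (forall x y, C x -> C y -> mdist x y <= M) -> (diameter C <= M%:E)%E.
Proof.
by move=> CM; apply: ge_ereal_sup => _ [[x y] [/= Cx Cy] <-]; rewrite lee_fin CM.
Qed.

Lemma mdist_lt_diameter (C : set X) (r : R) x y :
  (diameter C < r%:E)%E -> C x -> C y -> mdist x y < r.
Proof.
move=> Cr Cx Cy; rewrite -lte_fin; apply: le_lt_trans Cr.
by apply: ereal_sup_ubound; exists (x, y).
Qed.

(** Up to factors of [L], the distance between [alpha g 0] and [alpha k 0] depends only on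
    [g^-1 * k]. Growth along words gives the upper control function and properness the lower one. *)
Lemma fibred_embedding_of_aTmenable :
  uniformly_bounded_aTmenable R G -> uniformly_bounded_fibred_coarse_embedding X.
Proof.
move=> [H [alpha [H_sep [alpha_iso alphaM] [L L0 alphaL] alpha_proper]]].
have alpha_affine g : is_affine (alpha g) by have [psi []] := alpha_iso g.
have alpha1 x : alpha 1%g x = x.
  have [psi [_ _ alphaK _]] := alpha_iso 1%g.
  by apply: (can_inj alphaK); rewrite -[LHS]/((alpha 1%g \o alpha 1%g) x) -alphaM mulg1.
have alphaVK g : cancel (alpha g) (alpha (g^-1)%g).
  by move=> x; rewrite -[LHS]/((alpha (g^-1)%g \o alpha g) x) -alphaM mulVg alpha1.
have alphaKV g : cancel (alpha (g^-1)%g) (alpha g).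
  by move=> x; rewrite -[LHS]/((alpha g \o alpha (g^-1)%g) x) -alphaM mulgV alpha1.
have alpha_bai g : bounded_affine_inverses L (alpha g) (alpha (g^-1)%g) by split.
have alpha_lip g x y : `|alpha g x - alpha g y| <= L * `|x - y|.
  have [T [z TE]] := alpha_affine g.
  have TL : (op_norm T <= L%:E)%E by rewrite -(linear_partE TE); exact: alphaL.
  by rewrite !TE opprD addrACA subrr addr0 -linearB; exact: op_norm_bound.
have alpha_shift g k : alpha k 0 = alpha g (alpha (g^-1 * k)%g 0).
  by rewrite alphaM /= alphaKV.
have orbit_upper g k : `|alpha g 0 - alpha k 0| <= L * `|alpha (g^-1 * k)%g 0|.
  by rewrite distrC (alpha_shift g k) (le_trans (alpha_lip _ _ _))// subr0.
have orbit_lower g k : `|alpha (g^-1 * k)%g 0| / L <= `|alpha g 0 - alpha k 0|.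
  rewrite ler_pdivrMr // mulrC distrC.
  apply: le_trans (alpha_lip (g^-1)%g _ _).
  by rewrite (alpha_shift g k) !alphaVK subr0.
have [C [C0 SC]] : exists C : R, 0 <= C /\ forall s, S s -> `|alpha s 0| <= C.
  by apply: finite_set_bounded; have [] := S_gen.
have orbit_growth g : `|alpha g 0| <= L * C * (len g)%:R.
  have [w [wS <-] <-] := wordlenP S_gen g.
  elim/last_ind: w wS => [|w s IH] wS; first by rewrite big_nil alpha1 normr0 mulr0.
  rewrite -cats1 big_cat /= big_seq1 size_cat /=; set u := (\prod_(t <- w) t)%g in IH *.
  have us : `|alpha (u * s)%g 0 - alpha u 0| <= L * C.
    rewrite distrC (le_trans (orbit_upper _ _))// mulKg ler_pM2l // SC //.
    by apply: wS; rewrite mem_rcons mem_head.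
  have {}IH : `|alpha u 0| <= L * C * (size w)%:R.
    by apply: IH => t tw; apply: wS; rewrite mem_rcons inE tw orbT.
  move: IH us.
  have := ler_normD (alpha (u * s)%g 0 - alpha u 0) (alpha u 0); rewrite subrK.
  by rewrite natrD mulrDr mulr1; lra.
(* The [+ 1] makes [rho_p] tend to infinity even when [C = 0]. *)
pose rho_p (t : R) := (L * (L * C) + 1) * t.
(* The second summand makes [rho_m] tend to infinity even when [G] is finite. *)
pose rho_m (t : R) :=
  inf (range (fun u => `|alpha u 0| / L + Num.max 0 (t - (len u)%:R))).
have term_ge0 t u : 0 <= `|alpha u 0| / L + Num.max 0 (t - (len u)%:R).
  by rewrite addr_ge0 ?divr_ge0 ?(ltW L0) // le_max lexx.
have rho_m_le t u : rho_m t <= `|alpha u 0| / L + Num.max 0 (t - (len u)%:R).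
  by apply: ge_inf; [exists 0 => _ [v _ <-]|exists u].
have rho_m_ge t a : (forall u, a <= `|alpha u 0| / L + Num.max 0 (t - (len u)%:R)) ->
    a <= rho_m t.
  move=> au; apply: lb_le_inf; last by move=> _ [u _ <-].
  by exists (`|alpha 1%g 0| / L + Num.max 0 (t - (len 1%g)%:R)), 1%g.
have rho_p_control : control_function rho_p.
  have LC0 : 0 <= L * (L * C) by rewrite !mulr_ge0 // ltW.
  split=> [u v u0 uv|]; first by rewrite ler_wpM2l // addr_ge0.
  apply/cvgryPge => A; near=> t.
  have t0 : 0 <= t by near: t; apply: nbhs_pinfty_ge; exact: num_real.
  have tA : A <= t by near: t; apply: nbhs_pinfty_ge; exact: num_real.
  by rewrite /rho_p mulrDl mul1r; have := mulr_ge0 LC0 t0; lra.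
have rho_m_control : control_function rho_m.
  split=> [u v u0 uv|].
    apply: rho_m_ge => w; apply: le_trans (rho_m_le u w) _.
    by rewrite lerD2l ge_max !le_max lexx /= lerD2r uv orbT.
  apply/cvgryPge => A.
  have A_fin : finite_set [set u | `|alpha u 0| <= L * A].
    have ball_bounded : bounded_set [set x : H | `|x| <= `|L * A|].
      exists `|L * A|; split; first exact: num_real.
      by move=> M AM x /= /le_trans; apply; exact: ltW.
    apply: sub_finite_set (alpha_proper _ ball_bounded) => u uA.
    exists (alpha u 0); split; last exact: le_trans uA (ler_norm _).
    by exists 0 => //=; rewrite normr0.
  (* Elements with small displacement have length at most [D], so for [t >= A + D] their second
     summand is at least [A]; for the others the first one is. *)
  have [D [D0 DP]] := finite_set_bounded (fun u => (len u)%:R : R) A_fin.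
  near=> t; apply: rho_m_ge => u.
  have tAD : A + D <= t by near: t; apply: nbhs_pinfty_ge; exact: num_real.
  have [uA|/negP uA] := pselect (`|alpha u 0| <= L * A).
    have uD := DP u uA.
    apply: ler_wpDl; first by rewrite divr_ge0 // ltW.
    by rewrite le_max; apply/orP; right; lra.
  apply: ler_wpDr; first by rewrite le_max lexx.
  by rewrite ler_pdivlMr // mulrC; move: uA; rewrite -ltNge => /ltW.
exists H, L, (fun=> H), (fun=> 0), rho_m, rho_p; split=> // r r0.
pose m := (Num.truncn r).+1.
have rm : r < m%:R by rewrite /m truncnS_gt.
have [M0 M0P] := short_elements_trivial (3 * m).
pose M := maxn M0 m.
have small i n : (M <= i)%N -> N i n -> (len n <= 3 * m)%N -> n = 1%g.
  by move=> Mi; apply: M0P; exact: leq_trans (leq_maxl _ _) Mi.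
(* The removed set is the union of the first [M] layers, finite and so bounded. *)
pose K : set X := \bigcup_(i in `I_M) range (box_pt i).
have K_fin : finite_set K.
  by apply: bigcup_finite => [|i _]; [exact: finite_II|exact: finite_box_layer].
exists K.
  have [D [D0 DP]] := finite_set_bounded
    (fun p : X * X => mdist p.1 p.2) (finite_setX K_fin K_fin).
  by apply: le_lt_trans (diameter_le _) (ltry D) => x y Kx Ky; exact: (DP (x, y)).
move=> admissible.
have liftable C' : exists lift : X -> G, admissible C' -> exists2 i, (M <= i)%N &
    (forall x, C' x -> x = box_pt i (lift x)) /\
    forall x y, C' x -> C' y -> mdist x y = (len ((lift x)^-1 * lift y)%g)%:R.
  have [[CK Cr]|nadm] := pselect (admissible C'); last by exists (fun=> 1%g).
  have [|i g Cig|x y Cx Cy|lift [i Mi liftP]] := @box_lift m M C' small.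
  - exact: leq_maxr.
  - by rewrite leqNgt; apply/negP => iM; apply: (CK _ Cig); exists i => //; exists g.
  - exact: lt_trans (mdist_lt_diameter Cr Cx Cy) rm.
  by exists lift => _; exists i.
have {liftable}[lift liftP] := choice liftable.
exists (fun C' x => alpha (lift C' x)), (fun C' x => alpha ((lift C' x)^-1)%g).
split=> [//|C' x y adm Cx Cy|C1 C2 adm1 adm2 [z [C1z C2z]]].
  have [i _ [_ ->]] := liftP _ adm => //.
  apply/andP; split.
    apply: le_trans (rho_m_le _ ((lift C' x)^-1 * lift C' y)%g) _.
    (* At [t] equal to the length of [u] the second summand vanishes. *)
    by rewrite subrr max_l // addr0 orbit_lower.
  apply: le_trans (orbit_upper _ _) _.
  have := orbit_growth ((lift C' x)^-1 * lift C' y)%g.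
  rewrite -(ler_pM2l L0) => /le_trans; apply.
  by rewrite /rho_p mulrDl mul1r -!mulrA lerDl.
(* The transition is read off at one common point [z]; [box_lift_transition] shows that any other
   gives the same. *)
exists (alpha (lift C1 z * (lift C2 z)^-1)%g), (alpha (lift C1 z * (lift C2 z)^-1)^-1%g).
split=> // x [C1x C2x]; rewrite -alphaM; congr alpha.
have [i Mi [pt1 d1]] := liftP _ adm1; have [j Mj [pt2 d2]] := liftP _ adm2.
have ij : i = j.
  by apply: (@box_pt_index _ _ (lift C1 z) (lift C2 z)); rewrite -pt1 // -pt2.
subst j.
apply: (@box_lift_transition m i).
- by move=> n; exact: small.
- by rewrite -pt1 // -pt2.
- by rewrite -pt1 // -pt2.
- rewrite -(ler_nat R) -d1 // ltW // (lt_trans _ rm) //.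
  exact: mdist_lt_diameter adm1.2 C1z C1x.
- rewrite -(ler_nat R) -d2 // ltW // (lt_trans _ rm) //.
  exact: mdist_lt_diameter adm2.2 C2z C2x.
Unshelve. all: by end_near. Qed.

(** * From a fibred embedding to an action *)

Lemma bounded_set_avoids_layers (K : set X) :
  (diameter K < +oo)%E -> exists i0, forall i g, (i0 <= i)%N -> ~ K (box_pt i g).
Proof.
move=> K_bd; have [[x Kx]|K0] := pselect (K !=set0); last first.
  by exists 0%N => i g _ Kig; apply: K0; exists (box_pt i g).
have [j [h xE]] := box_pt_surj x.
have K_dist y : K y -> ((mdist y x)%:E <= diameter K)%E.
  by move=> Ky; apply: ereal_sup_ubound; exists (y, x).
have [D KD] : exists D : R, forall y, K y -> mdist y x <= D.
  case: (diameter K) K_bd K_dist => [D _ KD|//|_ KD]; first by exists D.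
  by have := KD x Kx.
(* Beyond [j] the layers differ from that of [x]; beyond [D] they are more than [D] away from
   [x]. *)
exists (maxn j.+1 (Num.truncn D).+1) => i g; rewrite geq_max => /andP[ji Di] Kig.
have ij : i <> j by move=> ij; rewrite ij ltnn in ji.
have := box_pt_far g h ij; rewrite -xE => /le_trans/(_ (KD _ Kig)).
rewrite leNgt => /negP; apply.
apply: lt_le_trans (truncnS_gt D) _; rewrite ler_nat.
exact: leq_trans Di (leq_addr _ _).
Qed.

Lemma bounded_affine_inverses_linear (H1 H2 : hilbertType R) (L : R)
    (psi : H1 -> H2) (psi' : H2 -> H1) :
  bounded_affine_inverses L psi psi' ->
  exists2 T : {linear H1 -> H2}, (forall h, `|T h| <= L * `|h|) &
    forall h k, psi h - psi k = T (h - k).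
Proof.
move=> [[[T [x psiE]] _ _ _] psiL _]; exists T => [h|h k].
  apply: op_norm_bound; rewrite -(linear_partE psiE); exact: psiL.
by rewrite !psiE opprD addrACA subrr addr0 linearB.
Qed.

Lemma aTmenable_of_fibred_embedding :
  uniformly_bounded_fibred_coarse_embedding X -> uniformly_bounded_aTmenable R G.
Proof.
move=> [H [L [Hx [s [rho_m [rho_p [_ L0 [m_mono m_oo] [p_mono _] emb]]]]]]].
(* The bound [2 * r] is the diameter of a ball of radius [r]; the embedding is applied with
   [2 * r + 1] because admissibility is strict. Only differences of section values are kept below,
   so the transitions enter through their linear parts. *)
pose adm (i r : nat) (C : set X) := C `<=` range (box_pt i) /\
  forall x y, C x -> C y -> mdist x y <= (2 * r)%:R.
have /choice[d dP] (r : nat) :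
    exists d : nat * (set X -> forall x, Hx x -> H), [/\ (r <= d.1)%N,
      forall C x y, adm d.1 r C -> C x -> C y ->
        rho_m (mdist x y) <= `|d.2 C x (s x) - d.2 C y (s y)| <= rho_p (mdist x y)
    & forall C1 C2, adm d.1 r C1 -> adm d.1 r C2 -> C1 `&` C2 !=set0 ->
        exists2 T : {linear H -> H}, (forall h, `|T h| <= L * `|h|) &
        forall x y, (C1 `&` C2) x -> (C1 `&` C2) y ->
          d.2 C1 x (s x) - d.2 C1 y (s y) = T (d.2 C2 x (s x) - d.2 C2 y (s y))].
  have r0 : 0 < (2 * r).+1%:R :> R by rewrite ltr0n.
  have [K K_bd [t [t' [t_inv t_bd t_tr]]]] := emb _ r0.
  have [i0 i0P] := bounded_set_avoids_layers K_bd.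
  have adm_admissible C : adm (maxn r i0) r C ->
      C `<=` ~` K /\ (diameter C < (2 * r).+1%:R%:E)%E.
    move=> [C_layer C_diam]; split.
      by move=> x /C_layer[g _ <-]; apply: i0P; exact: leq_maxr.
    apply: le_lt_trans (diameter_le C_diam) _.
    by rewrite lte_fin ltr_nat.
  exists (maxn r i0, t); split=> /=; first exact: leq_maxl.
    by move=> C x y /adm_admissible; exact: t_bd.
  move=> C1 C2 /adm_admissible adm1 /adm_admissible adm2 C12.
  have [tau [tau' [tau_bai tauE]]] := t_tr _ _ adm1 adm2 C12.
  have [T TL TE] := bounded_affine_inverses_linear tau_bai.
  have transport x : (C1 `&` C2) x -> t C1 x (s x) = tau (t C2 x (s x)).
    move=> C12x; rewrite -(tauE x C12x) /=.
    by have [[_ _ -> _]] := t_inv C2 x adm2 C12x.2.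
  by exists T => // x y C12x C12y; rewrite !transport // TE.
pose i r := (d r).1; pose t r := (d r).2.
pose C r x0 : set X := [set x | range (box_pt (i r)) x /\ mdist x0 x <= r%:R].
have C_adm r x0 : adm (i r) r (C r x0).
  split=> [x []//|x y [_ x0x] [_ x0y]].
  apply: le_trans (metric_triangle _ x0 _) _; rewrite metric_sym mul2n -addnn natrD.
  exact: lerD.
pose v r g x :=
  t r (C r (box_pt (i r) x)) (box_pt (i r) (x * g)%g) (s (box_pt (i r) (x * g)%g))
  - t r (C r (box_pt (i r) x)) (box_pt (i r) x) (s (box_pt (i r) x)).
have C_mem r x g : (len g <= r)%N -> C r (box_pt (i r) x) (box_pt (i r) (x * g)%g).
  move=> gr; split; first by exists (x * g)%g.
  by apply: le_trans (box_pt_dist_le _ _ _) _; rewrite mulKg ler_nat.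
have C_self r x : C r (box_pt (i r) x) (box_pt (i r) x).
  by rewrite -{2}[x]mulg1; apply: C_mem; rewrite wordlen1.
have v_bounds r g x : (len g <= r)%N ->
    rho_m (mdist (box_pt (i r) x) (box_pt (i r) (x * g)%g)) <= `|v r g x|
      <= rho_p (mdist (box_pt (i r) x) (box_pt (i r) (x * g)%g)).
  move=> gr; have [_ bd _] := dP r.
  by rewrite (metric_sym (box_pt (i r) x)); apply: bd (C_adm _ _) _ _;
    [exact: C_mem|exact: C_self].
apply: (@aTmenable_of_averages _ _ S (fun r => N (i r)) H v L) => //.
- move=> r g x n Nn; have xn : box_pt (i r) (x * n)%g = box_pt (i r) x.
    by apply/esym/box_pt_coset; rewrite mulKg.
  by rewrite /v xn (box_pt_mulr g xn).
- by move=> r x; rewrite /v mulg1 subrr.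
- move=> g; exists (rho_p (len g)%:R); near=> r => x.
  have gr : (len g <= r)%N by near: r; exact: nbhs_infty_ge.
  have /andP[_ /le_trans] := v_bounds r g x gr; apply; apply: p_mono.
    exact: mdist_ge0.
  by apply: le_trans (box_pt_dist_le _ _ _) _; rewrite mulKg.
- move=> M; have /cvgryPge/(_ M)[A [_ AP]] := m_oo.
  (* Once [N (i r)] has no nontrivial element of length up to [2 * len g], the points of [x] and
     [x * g] are at distance exactly [len g]. *)
  exists (Num.truncn A).+1 => g gA; have [D DP] := short_elements_trivial (2 * len g).
  near=> r => x.
  have gr : (len g <= r)%N by near: r; exact: nbhs_infty_ge.
  have Dr : (D <= r)%N by near: r; exact: nbhs_infty_ge.
  have /andP[+ _] := v_bounds r g x gr; rewrite box_pt_dist_eq mulKg.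
    move=> /(le_trans _); apply; apply: AP.
    by apply: lt_le_trans (truncnS_gt A) _; rewrite ler_nat ltnW.
  by move=> n; apply: DP; apply: leq_trans Dr _; have [] := dP r.
(* With [r >= len g + n0], the points of [x * g] and of all [x * g * h], [h] occurring in [c], lie
   in both the ball around [x] and the ball around [x * g]. *)
move=> g c; pose n0 := (\max_(a <- c) len a.2)%N.
near=> r => x.
have r_ge : (len g + n0 <= r)%N by near: r; exact: nbhs_infty_ge.
have gr : (len g <= r)%N by apply: leq_trans r_ge; exact: leq_addr.
have [_ _ tr] := dP r.
have [|T TL TE] := tr _ _ (C_adm r (box_pt (i r) x)) (C_adm r (box_pt (i r) (x * g)%g)).
  by exists (box_pt (i r) (x * g)%g); split; [exact: C_mem|exact: C_self].
rewrite comb_translate.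
suff -> : comb (fun h => v r (g * h)%g x - v r g x) c = T (comb (v r ^~ (x * g)%g) c).
  exact: TL.
rewrite linear_comb /comb !big_seq; apply: eq_bigr => a ac /=; congr (_ *: _).
have an0 : (len a.2 <= n0)%N by apply: (@leq_bigmax_seq _ _ xpredT (fun a => len a.2)).
(* The terms at [x] cancel, leaving a difference of values at two points common to the balls, to
   which [TE] applies. *)
rewrite /v mulgA opprB addrA subrK; apply: TE; split.
- rewrite -mulgA; apply: C_mem; apply: leq_trans (wordlenM S_gen _ _) _.
  by apply: leq_trans r_ge; rewrite leq_add2l.
- apply: C_mem; apply: leq_trans an0 _.
  by apply: leq_trans r_ge; exact: leq_addl.
- exact: C_mem.
- exact: C_self.
Unshelve. all: by end_near. Qed.

End BoxSpace.

Theorem theorem1p1 (R : realType) (G : groupType) (S : set G)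
    (N : nat -> set G) (X : metricType R)
    (iota : forall i : nat, left_cosets (N i) -> X) :
  finite_symmetric_generating S ->
  residually_finite G ->
  N 0%N = setT ->
  (forall i, normal_subgroup (N i)) ->
  (forall i, finite_index (N i)) ->
  (forall i, N i.+1 `<=` N i) ->
  \bigcap_i N i = [set 1%g] ->
  box_space S iota ->
  (uniformly_bounded_aTmenable R G <->
  uniformly_bounded_fibred_coarse_embedding X).
Proof.
move=> S_gen _ _ N_normal N_index N_decr N_cap X_box; split.
  exact: fibred_embedding_of_aTmenable S_gen N_normal N_index N_decr N_cap X_box.
exact: aTmenable_of_fibred_embedding S_gen N_normal N_index N_decr N_cap X_box.
Qed.
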